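(* Let $G$ be a connected finite graph on at least three vertices such that every ball of radius $3$ in $G$ is $2$-connected and $d(x)+d(y)+d(z)\ge |M_3(v)|+\kappa(G_3(v))$ for every vertex $v\in V(G)$ and for all triples $x,y,z$ of pairwise non-adjacent interior vertices of $G_3(v)$. Then $G$ is Hamiltonian.
   Context: Graphs have no loops or multiple edges; $d(w)$ is the degree of $w$. $M_r(u)$ is the set of vertices at distance at most $r$ from $u$, and the ball $G_r(u)$ is the subgraph induced by $M_r(u)$. A vertex $w$ of $G_r(u)$ is an interior vertex of $G_r(u)$ if the ball $G_1(w)$ is a subgraph of $G_r(u)$. $\kappa(H)$ is the smallest number of vertices whose removal turns $H$ into a disconnected or trivial graph. A finite graph is Hamiltonian if it has a cycle through all its vertices. *)

(* Defs.v *)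
From mathcomp Require Import all_boot.
Set Implicit Arguments.
Unset Strict Implicit.
Unset Printing Implicit Defensive.

(* Finite simple graphs whose vertices are drawn from an ambient finite type T,
   so that a graph and its subgraphs live in the same type. *)
Record sgraph (T : finType) := SGraph {
  verts : {set T};
  edge : rel T;
  edge_sym : symmetric edge;
  edge_irr : irreflexive edge;
  edge_verts : forall x y, edge x y -> x \in verts
}.

Section Graphs.
Variable T : finType.
Implicit Types (G H : sgraph T) (A S : {set T}) (u v w x y z : T).

Definition subgraph H G : Prop :=
  verts H \subset verts G /\ (forall x y, edge H x y -> edge G x y).

Definition induced_edge G A : rel T :=
  [rel x y | [&& x \in A, y \in A & edge G x y]].

Fact induced_sym G A : symmetric (induced_edge G A).
Proof. by move=> x y; rewrite /induced_edge /= edge_sym andbCA. Qed.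

Fact induced_irr G A : irreflexive (induced_edge G A).
Proof. by move=> x; rewrite /induced_edge /= edge_irr !andbF. Qed.

Fact induced_verts G A x y : induced_edge G A x y -> x \in verts G :&: A.
Proof. by case/and3P=> xA _ /edge_verts xG; rewrite inE xG. Qed.

Definition induced G A : sgraph T :=
  SGraph (induced_sym G A) (induced_irr G A) (@induced_verts G A).

Definition remove G S : sgraph T := induced G (~: S).

Definition deg G x : nat := #|[set y | edge G x y]|.

Definition connected G : bool :=
  [forall x in verts G, forall y in verts G, connect (edge G) x y].

(* The distance from u to w is at most r iff some walk of length at most r
   leads from u to w. *)
Definition dist_le G r u w : bool :=
  [exists n : 'I_r.+1, exists p : n.-tuple T,
    path (edge G) u p && (last u p == w)].

Definition ball_verts G r u : {set T} := [set w in verts G | dist_le G r u w].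

Definition ball G r u : sgraph T := induced G (ball_verts G r u).

Definition interior G r u w : Prop :=
  w \in verts (ball G r u) /\ subgraph (ball G 1 w) (ball G r u).

(* The empty graph is counted as trivial, so that removing all vertices is
   always admissible; for a graph with a vertex this does not affect the
   minimum, as removing all vertices but one also leaves a trivial graph. *)
Definition trivial_graph G : bool := #|verts G| <= 1.

Definition cutting G S : bool :=
  (S \subset verts G)
  && (~~ connected (remove G S) || trivial_graph (remove G S)).

Fact cutting_verts G : cutting G (verts G).
Proof.
by rewrite /cutting subxx /trivial_graph /= setICr cards0 orbT.
Qed.

(* By cutting_verts the default of the arg min is itself admissible. *)
Definition kappa G : nat := #|[arg min_(S < verts G | cutting G S) #|S|]|.

Definition k_connected k G : bool := k <= kappa G.

Definition hamiltonian G : Prop :=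
  exists c : seq T, [/\ ucycle (edge G) c, 2 < size c & c =i verts G].

End Graphs.

(* Main.v *)
Require Import Defs.
From mathcomp Require Import all_boot zify.
Set Implicit Arguments.
Unset Strict Implicit.
Unset Printing Implicit Defensive.

(* Let [C] be a longest cycle and suppose that it misses a vertex.
   First, some missed vertex [h] has two neighbours on some longest cycle.  Otherwise a
   component [H] of [G - C] attached at [w] is attached elsewhere within the 2-connected ball
   around [w]; the degree condition forces the successors of the two attachments far apart,
   while rotating a path through [H] that covers [C] brings them close together.
   Call such [(C, h)] a configuration, and let [o] be the successor on [C] of a neighbour of
   [h], chosen over all configurations so that the connectivity [k] of the ball around [o]
   is minimal.  The vertex [h] and the successors of its neighbours are independent and at
   distance at most two from [o].  Counting degrees in that ball along the path from [o] to
   another successor, only neighbours of [o] are moved, and by one step, so the count stays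
   inside the ball.  It gives [k - 1] successors that can be exchanged with [h] on the cycle,
   and these exchanges keep [o] as a possible choice.  A cut [S] of size [k] of the ball
   around [o] contains every vertex missed in this way: otherwise [h], a successor and a
   vertex beyond [S] violate the degree condition, in this ball or, when that vertex is not
   interior, in a nearby ball of smaller connectivity.  Hence [S] consists of [h] and the
   [k - 1] exchangeable vertices, and equality in the count leaves [h] as the only link
   between the two sides of [S], although [k >= 2]. *)

(** * Balls of a graph, their connectivity and their minimum cuts *)

Section Balls.
Variables (T : finType) (G : sgraph T).
Implicit Types (x y z u v w h o : T) (p q c : seq T).

Local Notation e := (edge G).
Local Notation M := (ball_verts G).

Definition nbrs x : {set T} := [set y | e x y].
Local Notation N := nbrs.

Lemma edgeC x y : e x y -> e y x. Proof. by rewrite edge_sym. Qed.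

Lemma nedgeC x y : ~ e x y -> ~ e y x. Proof. by move=> h /edgeC. Qed.

Lemma e_neq x y : e x y -> x != y.
Proof. by move=> h; apply/eqP=> E; move: h; rewrite E edge_irr. Qed.

Lemma e_vertl x y : e x y -> x \in verts G. Proof. exact: edge_verts. Qed.

Lemma e_vertr x y : e x y -> y \in verts G.
Proof. by move/edgeC; apply: edge_verts. Qed.

Lemma dist_leP r u w :
  reflect (exists p, [/\ size p <= r, path e u p & last u p = w]) (dist_le G r u w).
Proof.
apply: (iffP existsP) => [[n /existsP[p /andP[pp /eqP pl]]]|[p [sp pp pl]]].
  by exists p; rewrite size_tuple; split=> //; have := ltn_ord n.
have sp' : size p < r.+1 by [].
exists (Ordinal sp'); apply/existsP; exists (in_tuple p) => /=.
by rewrite pp pl eqxx.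
Qed.

Lemma ball_refl r v : v \in verts G -> v \in M r v.
Proof. by move=> vG; rewrite inE vG; apply/dist_leP; exists [::]. Qed.

Lemma ball_step r v x y : x \in M r v -> e x y -> y \in M r.+1 v.
Proof.
rewrite !inE => /andP[_ /dist_leP[p [sp pp pl]]] xy; rewrite (e_vertr xy).
apply/dist_leP; exists (rcons p y); rewrite size_rcons rcons_path pp pl last_rcons.
by split.
Qed.

Lemma ball_mono r (s : nat) v x : r <= s -> x \in M r v -> x \in M s v.
Proof.
rewrite !inE => rs /andP[-> /dist_leP[p [sp pp pl]]]; apply/dist_leP.
by exists p; split=> //; apply: leq_trans rs.
Qed.

Lemma ballW r v x : x \in M r v -> x \in M r.+1 v.
Proof. exact: ball_mono (leqnSn r). Qed.

Lemma ball_vert r v x : x \in M r v -> x \in verts G.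
Proof. by rewrite inE => /andP[]. Qed.

Lemma ball1_edge v x : e v x -> x \in M 1 v.
Proof. by move=> vx; apply: (ball_step (r := 0) _ vx); apply: ball_refl (e_vertl vx). Qed.

Lemma ball2_edges v x y : e v x -> e x y -> y \in M 2 v.
Proof. by move=> /ball1_edge; apply: ball_step. Qed.

Lemma ball_cons r v u x : e v u -> x \in M r u -> x \in M r.+1 v.
Proof.
move=> vu; rewrite !inE => /andP[-> /dist_leP[p [sp pp pl]]]; apply/dist_leP.
by exists (u :: p); rewrite /= vu.
Qed.

Lemma ball_uncons r v x : x \in M r.+1 v -> x = v \/ exists2 u, e v u & x \in M r u.
Proof.
rewrite !inE => /andP[xG /dist_leP[[|u p] [/= sp pp pl]]]; first by left.
right; case/andP: pp => vu pp; exists u => //; rewrite inE xG; apply/dist_leP.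
by exists p.
Qed.

Lemma ball0 v x : x \in M 0 v -> x = v.
Proof. by rewrite inE => /andP[_ /dist_leP[[|u p] [//= _ _ ->]]]. Qed.

Lemma ball_sym r v x : v \in verts G -> x \in M r v -> v \in M r x.
Proof.
elim: r v => [|r IH] v vG; first by move/ball0=> ->; apply: ball_refl.
case/ball_uncons=> [->|[u vu xu]]; first exact: ball_refl.
exact: ball_step (IH _ (e_vertr vu) xu) (edgeC vu).
Qed.

Lemma ball_center r v x : x \in M r v -> v \in verts G.
Proof.
case: r => [|r] xM; first by rewrite -(ball0 xM) (ball_vert xM).
by case: (ball_uncons xM) => [<-|[u /e_vertl]] //; apply: ball_vert xM.
Qed.

Lemma ball1P v x : x \in M 1 v -> x = v \/ e v x.
Proof. by case/ball_uncons=> [|[u vu /ball0->]]; [left|right]. Qed.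

Lemma ball2P v x : x \in M 2 v -> [\/ x = v, e v x | exists2 t, e v t & e t x].
Proof.
case/ball_uncons=> [|[u vu /ball1P[->|ux]]]; first by constructor 1.
  by constructor 2.
by constructor 3; exists u.
Qed.

Lemma ball_last r v x : x \in M r.+1 v -> x \in M r v \/ exists2 u, u \in M r v & e u x.
Proof.
rewrite !inE => /andP[xG /dist_leP[p [sp pp pl]]].
case: (lastP p) sp pp pl => [|p' u] => [_ _ /= vx|].
  by left; rewrite xG; apply/dist_leP; exists [::].
rewrite size_rcons rcons_path last_rcons => sp /andP[pp ux] uE; subst u.
right; exists (last v p') => //; rewrite inE (e_vertl ux).
by apply/dist_leP; exists p'.
Qed.

Lemma nbrs_ball r v x : x \in M r v -> N x \subset M r.+1 v.
Proof. by move=> xv; apply/subsetP=> y; rewrite inE => /(ball_step xv). Qed.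

(** One further step from distance two stays in the ball of radius three. This is how vertices
    qualify for the degree condition from here on. *)
Lemma interior2 v x : x \in M 2 v -> interior G 3 v x.
Proof.
move=> xv; have sub y : y \in M 1 x -> y \in M 3 v.
  by move/ball1P=> [->|xy]; [apply: ball_mono xv | apply: ball_step xv xy].
split; first by rewrite inE (ball_vert xv) (ball_mono (r := 2)).
split=> [|y z /and3P[/sub yv /sub zv yz]]; last by apply/and3P.
apply/subsetP=> y; rewrite !inE => /andP[yG /andP[_ y1]]; rewrite yG /=.
by have := sub y; rewrite !inE yG y1 => /(_ isT).
Qed.

Definition ball_conn v := kappa (ball G 3 v).
Local Notation K := ball_conn.

Lemma kappa_min (H : sgraph T) (S : {set T}) : cutting H S -> kappa H <= #|S|.
Proof.
by move=> cS; rewrite /kappa; case: arg_minnP => [|S' _ ->]; first exact: cutting_verts.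
Qed.

Lemma kappa_cut (H : sgraph T) : exists2 S, cutting H S & #|S| = kappa H.
Proof.
rewrite /kappa; case: arg_minnP => [|S' cS _]; first exact: cutting_verts.
by exists S'.
Qed.

Lemma verts_ball v : verts (ball G 3 v) = M 3 v.
Proof.
apply/setP=> x; rewrite inE; apply/andP/idP => [[]//|xM]; split=> //.
exact: ball_vert xM.
Qed.

Lemma verts_remove v S : verts (remove (ball G 3 v) S) = M 3 v :\: S.
Proof. by rewrite setDE -verts_ball. Qed.

Lemma edge_removeE v S x y :
  edge (remove (ball G 3 v) S) x y = [&& x \in M 3 v :\: S, y \in M 3 v :\: S & e x y].
Proof.
rewrite /remove /induced /= /induced_edge /= /induced_edge /= !in_setC !in_setD.
by case: (x \in S); case: (y \in S); case: (x \in M 3 v); case: (y \in M 3 v).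
Qed.

(** [B] stands for what is reachable from [x]: a walk in the ball that avoids [S] never leaves [B],
    so it misses [y]. *)
Lemma disconnected_kappa v (S B : {set T}) x y :
    S \subset M 3 v -> x \in B -> y \in M 3 v :\: S -> y \notin B -> x \in M 3 v :\: S ->
    (forall a b, a \in B -> b \in M 3 v :\: S -> e a b -> b \in B) ->
  K v <= #|S|.
Proof.
move=> SM xB yM yB xM Bcl; apply: kappa_min; rewrite /cutting verts_ball SM /=.
apply/orP; left; apply/negP=> /forall_inP cxy.
have xR : x \in verts (remove (ball G 3 v) S) by rewrite verts_remove.
have yR : y \in verts (remove (ball G 3 v) S) by rewrite verts_remove.
have /connectP[p pp yE] := forall_inP (cxy x xR) y yR.
case/negP: yB; rewrite {}yE; have := edge_removeE v S.
move: (edge (remove _ _)) pp => E pp EE.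
elim: p x xB pp {xM xR} => //= a p IH x xB /andP[xa pa].
apply: IH pa; move: xa; rewrite EE => /and3P[_ aM xa].
exact: Bcl xB aM xa.
Qed.

(** The sides of the cut are named only after a vertex [x] outside it, so each use decides which
    vertex lies in [B1]. *)
Definition separates v (S : {set T}) := [/\ S \subset M 3 v, #|S| = K v
    & forall x, x \in M 3 v :\: S -> exists B1 B2 : {set T},
      [/\ x \in B1, exists z, z \in B2, B1 :|: B2 = M 3 v :\: S,
         [disjoint B1 & B2] & forall y z, y \in B1 -> z \in B2 -> ~ e y z]].

(** The non-adjacent pair excludes a complete ball, whose minimum is attained by leaving a trivial
    graph. *)
Lemma min_cut v a b : a \in M 3 v -> b \in M 3 v -> a != b -> ~ e a b ->
  exists S, separates v S.
Proof.
move=> aM bM ab nab; have [S cS SK] := kappa_cut (ball G 3 v).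
have [SM S2] : S \subset M 3 v /\ (~~ connected (remove (ball G 3 v) S)).
  move: cS; rewrite /cutting verts_ball => /andP[SM /orP[|]]; first by split.
  rewrite /trivial_graph verts_remove => S1.
  have abM : [set a; b] \subset M 3 v by apply/subsetP=> x /set2P[->|->].
  (* A set leaving at most one vertex is larger than the set of all vertices but [a] and [b], which
     already disconnects the ball. *)
  have : kappa (ball G 3 v) <= #|M 3 v :\: [set a; b]|.
    apply: (@disconnected_kappa v _ [set a] a b); rewrite ?subsetDl ?set11 //.
    - by rewrite !in_setD bM !inE eqxx orbT.
    - by rewrite !inE eq_sym.
    - by rewrite !in_setD aM !inE eqxx.
    move=> x y; rewrite !in_setD !in_set1 in_set2 => /eqP-> /andP[+ yM].
    rewrite yM andbT negbK => /orP[]/eqP-> //; by rewrite edge_irr.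
  have := cardsD (M 3 v) [set a; b]; rewrite (setIidPr abM) cards2 ab.
  have := cardsD (M 3 v) S; rewrite (setIidPr SM).
  have := subset_leq_card abM; rewrite cards2 ab.
  have := subset_leq_card SM; lia.
exists S; split=> // x xM.
have := edge_removeE v S; have := verts_remove v S.
move: (remove _ _) S2 => R S2 vR eR.
exists [set y in M 3 v :\: S | connect (edge R) x y],
       [set y in M 3 v :\: S | ~~ connect (edge R) x y].
have csym : connect_sym (edge R) by apply: sym_connect_sym; apply: edge_sym.
split.
- by rewrite in_set xM connect0.
- apply/existsP; apply: contraNT S2; rewrite negb_exists => /forallP nB.
  have all_x y : y \in M 3 v :\: S -> connect (edge R) x y.
    by move=> yM; have := nB y; rewrite in_set yM negbK.
  rewrite /connected vR; apply/forall_inP=> y yM; apply/forall_inP=> z zM.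
  by apply: connect_trans (all_x z zM); rewrite csym all_x.
- by apply/setP=> y; rewrite in_setU !in_set; case: connect; rewrite /= ?andbT ?andbF ?orbF.
- by rewrite disjoints_subset; apply/subsetP=> y; rewrite in_setC !in_set => /andP[-> ->].
move=> y z; rewrite in_set => /andP[yM xy]; rewrite in_set => /andP[zM xz] yz.
case/negP: xz; apply: connect_trans xy _; apply: connect1.
by rewrite eR yM zM.
Qed.
End Balls.

(** * Paths as vertex lists, and neighbourhoods shifted along them *)

Section Paths.
Variables (T : finType) (G : sgraph T).
Implicit Types (x y z u v w h o a b d : T) (p q c : seq T).
Local Notation e := (edge G).
Local Notation N := (nbrs G).

(** The list contains both ends, so joining and reversing paths are plain list operations. *)
Definition pathto a b p : bool :=
  if p is x :: t then [&& x == a, path e x t & last x t == b] else false.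

Lemma pathto1 a : pathto a a [:: a].
Proof. by rewrite /= !eqxx. Qed.

Lemma pathto_cat a b u v p q : pathto a b p -> e b u -> pathto u v q -> pathto a v (p ++ q).
Proof.
case: p => // x t /and3P[/eqP-> xt /eqP bE] bu; case: q => // y s /and3P[/eqP-> ys /eqP<-].
by rewrite /= eqxx cat_path last_cat /= bE bu xt ys eqxx.
Qed.

Lemma pathto_cons a b u p : e a u -> pathto u b p -> pathto a b (a :: p).
Proof. exact: (pathto_cat (pathto1 a)). Qed.

Lemma pathto_rev a b p : pathto a b p -> pathto b a (rev p).
Proof.
case: p => // x t /and3P[/eqP-> xt /eqP<-]; rewrite lastI rev_rcons /= eqxx /=.
have -> : path e (last a t) (rev (belast a t)).
  by rewrite rev_path; apply: sub_path xt => y z; rewrite edge_sym.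
by case: t {xt} => [|y t] /=; rewrite ?eqxx // rev_cons last_rcons eqxx.
Qed.

Lemma pathto_cat_inv a b p q : p != [::] -> q != [::] -> pathto a b (p ++ q) ->
  exists u v, [/\ pathto a u p, e u v & pathto v b q].
Proof.
case: p => // x t _; case: q => // y s _ /and3P[/eqP->].
rewrite cat_path last_cat => /andP[at_ /= /andP[ay ys]] /eqP yb.
by exists (last a t), y; rewrite /= !eqxx at_ ys yb eqxx.
Qed.

Lemma pathto_split a b p x q : pathto a b (p ++ x :: q) ->
  pathto a x (rcons p x) /\ pathto x b (x :: q).
Proof.
case: p => [|y p]; first by case/and3P=> /eqP-> pq lb; rewrite /= !eqxx pq lb.
case/pathto_cat_inv=> // u [v [pau uv pvb]].
have xv : x = v by case/and3P: pvb => /eqP.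
by rewrite xv in pvb *; split=> //; rewrite -cats1; apply: pathto_cat uv (pathto1 v).
Qed.

Lemma pathto_head a b p : pathto a b p -> exists t, p = a :: t.
Proof. by case: p => // x t /and3P[/eqP->]; exists t. Qed.

Lemma pathto_last a b p : pathto a b p -> exists t, p = rcons t b.
Proof. by case/pathto_rev/pathto_head=> t E; exists (rev t); rewrite -rev_cons -E revK. Qed.

Lemma pathto_neq a b p : pathto a b p -> uniq p -> 1 < size p -> a != b.
Proof.
case: p => // x [|y t] // /and3P[/eqP-> _ /= /eqP bE] /= /andP[aN _] _.
by apply: contraNneq aN => ->; rewrite -bE mem_last.
Qed.

(* Outside [p], and at the last vertex of [p], the successor is the vertex itself. *)
Definition succ_in p x := nth x p (index x p).+1.

Lemma succ_notin p x : x \notin p -> succ_in p x = x.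
Proof. by move=> xp; rewrite /succ_in memNindex // nth_default. Qed.

Lemma succ_cat p x y q : uniq (p ++ x :: y :: q) -> succ_in (p ++ x :: y :: q) x = y.
Proof.
rewrite cat_uniq => /and3P[_ /= /norP[xp _] _].
by rewrite /succ_in index_cat (negbTE xp) /= eqxx addn0 nth_cat ltnNge leqnSn /= subSnn.
Qed.

Lemma succ_last p x : uniq (rcons p x) -> succ_in (rcons p x) x = x.
Proof.
rewrite rcons_uniq => /andP[xp _].
by rewrite /succ_in -cats1 index_cat (negbTE xp) /= eqxx addn0 nth_default // size_cat addn1.
Qed.

Lemma succ_split p x : uniq p -> x \in p -> (exists t, p = rcons t x) \/
  exists s1 s2, p = s1 ++ x :: succ_in p x :: s2.
Proof.
move=> Up xp; case/splitPr: p / xp Up => s1 [|y s2] Up; first by left; exists s1; rewrite cats1.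
by right; exists s1, s2; rewrite succ_cat.
Qed.

Lemma succ_edge a b p x : uniq p -> pathto a b p -> succ_in p x = x \/ e x (succ_in p x).
Proof.
move=> Up pp; case: (boolP (x \in p)) => [xp|/succ_notin]; last by left.
case: (succ_split Up xp) => [[t E]|[s1 [s2 E]]].
  by left; rewrite E succ_last // -E.
right; rewrite E in pp; have [_] := pathto_split pp.
by case/and3P=> _ /= /andP[].
Qed.

Lemma succ_block (s1 r : seq T) y s2 x : uniq (s1 ++ r ++ y :: s2) -> x \in r ->
  succ_in (s1 ++ r ++ y :: s2) x \in r \/
    (exists r', r = rcons r' x) /\ succ_in (s1 ++ r ++ y :: s2) x = y.
Proof.
move=> U xr; case/splitPr: r / xr U => r1 [|z r2] U.
  right; split; first by exists r1; rewrite cats1.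
  by move: U; rewrite -catA /= catA => U; rewrite succ_cat.
left; move: U; rewrite -catA /= catA => U.
by rewrite succ_cat // mem_cat !inE eqxx !orbT.
Qed.

(** If the last vertex of [p] is not a neighbour of [a], these are the neighbours of [a] moved back
    one step along [p], those off [p] staying in place, as in Ore's argument. *)
Definition shift_nbrs p a : {set T} := [set x | e a (succ_in p x)].

(** Every neighbour of [a] is a value of [succ_in p] on the shifted set: a neighbour on [p] is not
    its first vertex [a], so it has a predecessor. *)
Lemma card_shift a b p : uniq p -> pathto a b p -> ~ e a b -> deg G a <= #|shift_nbrs p a|.
Proof.
move=> Up pp ab; rewrite -[deg G a]/#|N a|.
apply: leq_trans (leq_imset_card (succ_in p) _); apply/subset_leq_card/subsetP=> v.
rewrite inE => av; apply/imsetP.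
case: (boolP (v \in p)) => [vp|/succ_notin vn]; last by exists v; rewrite ?inE ?vn.
case/splitPr: p / vp Up pp => s1 s2.
case: (lastP s1) => [|t x] Up pp.
  by case/and3P: pp => /eqP va; move: av; rewrite va edge_irr.
rewrite -cats1 -catA /= in Up pp *; exists x; rewrite ?inE succ_cat //.
Qed.

(** One step leads from [a] to a neighbour, and at most one more back along [p]. *)
Lemma shift_ball r v a b p : uniq p -> pathto a b p -> a \in ball_verts G r v ->
  shift_nbrs p a \subset ball_verts G r.+2 v.
Proof.
move=> Up pp ac; apply/subsetP=> x; rewrite inE => ax.
have nc := ball_step ac ax.
case: (succ_edge x Up pp) => [<-|/edgeC xn]; first exact: ball_mono nc.
exact: ball_step nc xn.
Qed.

End Paths.

(** * Cardinalities of disjoint sets *)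

Section Counting.
Variable T : finType.
Implicit Types A B D : {set T}.

Lemma cards_disjU A B : [disjoint A & B] -> #|A :|: B| = #|A| + #|B|.
Proof. by rewrite cardsU -setI_eq0 => /eqP->; rewrite cards0 subn0. Qed.

Lemma disjP A B : (forall x, x \in A -> x \in B -> False) -> [disjoint A & B].
Proof.
move=> h; rewrite -setI_eq0; apply/eqP/setP=> x; rewrite !inE.
by apply/negP=> /andP[/h].
Qed.

Lemma cards_disj3 A B D : [disjoint A & B] -> [disjoint A & D] -> [disjoint B & D] ->
  #|A :|: B :|: D| = #|A| + #|B| + #|D|.
Proof.
move=> AB AD BD; rewrite !cards_disjU //; apply: disjP => x; rewrite inE => /orP[] xA xD.
  by have := disjointFr AD xA; rewrite xD.
by have := disjointFr BD xA; rewrite xD.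
Qed.

Lemma card_miss A B x : A \subset B -> x \in B -> x \notin A -> #|A| < #|B|.
Proof. by move=> AB xB xA; apply: proper_card; apply/properP; split=> //; exists x. Qed.

Lemma card_sub1 A x : (forall y, y \in A -> y = x) -> #|A| <= 1.
Proof.
move=> h; rewrite -(cards1 x); apply/subset_leq_card/subsetP=> y /h->.
by rewrite set11.
Qed.

End Counting.

(** * Paths with more vertices than any cycle, and their rotations *)

Section Longest.
Variables (T : finType) (G : sgraph T) (L : nat).
Implicit Types (x y z u v w h o a b d q : T) (p c C D : seq T).
Local Notation e := (edge G).
Local Notation N := (nbrs G).
Local Notation M := (ball_verts G).
Local Notation K := (ball_conn G).
Local Notation pathto := (pathto G).
Local Notation shift_nbrs := (shift_nbrs G).

Hypothesis K_ge2 : forall v, v \in verts G -> 2 <= K v.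
Hypothesis deg_sum : forall v x y z,
  x \in M 2 v -> y \in M 2 v -> z \in M 2 v -> x != y -> y != z -> x != z ->
  ~ e x y -> ~ e y z -> ~ e x z -> #|M 3 v| + K v <= deg G x + deg G y + deg G z.
Hypothesis L_gt2 : 2 < L.
Hypothesis L_max : forall c, ucycle e c -> 2 < size c -> size c <= L.

(** An edge between the ends of such a path would close a cycle longer than the maximum [L]. *)
Definition linked a b p := [/\ pathto a b p, uniq p & L < size p].

Lemma no_long_cycle a b p : linked a b p -> ~ e b a.
Proof.
case=> pp Up Lp ba; have [t E] := pathto_head pp.
have: ucycle e p.
  rewrite /ucycle Up andbT E /= rcons_path; move: pp; rewrite E.
  by case/and3P=> _ -> /eqP->.
by move/L_max; move: (L_max) L_gt2 Lp; lia.
Qed.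

Lemma linked_rev a b p : linked a b p -> linked b a (rev p).
Proof. by case=> pp Up Lp; split; rewrite ?rev_uniq ?size_rev //; apply: pathto_rev. Qed.

Lemma linked_nadj a b p : linked a b p -> ~ e a b.
Proof. by move/no_long_cycle=> h /edgeC. Qed.

Lemma linked_neq a b p : linked a b p -> a != b.
Proof. by case=> pp Up Lp; apply: pathto_neq pp Up _; lia. Qed.

(** Pósa rotation: the edge from [a] to [y] replaces the one from [x] to [y], and the part up to [x]
    is reversed. *)
Lemma linked_rot a b p s x y t : linked a b p -> p = s ++ x :: y :: t -> e a y ->
  linked x b (rev (rcons s x) ++ y :: t).
Proof.
case=> pp Up Lp E ay; rewrite E in pp Up Lp.
have [p1 p2] := pathto_split pp.
have p3 : pathto y b (y :: t) by case: (@pathto_split T G x b [:: x] y t p2).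
split; first exact: pathto_cat (pathto_rev p1) ay p3.
  have : perm_eq (rev (rcons s x) ++ y :: t) (s ++ x :: y :: t).
    by rewrite -[s ++ _]cat_rcons perm_cat2r perm_rev.
  by move/perm_uniq->.
by move: Lp; rewrite !size_cat size_rev size_rcons /=; lia.
Qed.

(** Ore's crossing argument: rotation makes [x] an end of a path to [b] on the same vertices, and
    that path must not close up. *)
Lemma linked_shift a b p x : linked a b p -> x \in shift_nbrs p a -> ~ e x b.
Proof.
move=> lk; have [pp Up Lp] := lk; rewrite inE => ax xb.
case: (boolP (x \in p)) => [xp|xp].
  case: (succ_split Up xp) => [[t E]|[s1 [s2 E]]].
    have [t' E'] := pathto_last pp; rewrite E' in E; have xE : b = x by case/rcons_inj: E.
    by rewrite xE edge_irr in xb.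
  exact: (no_long_cycle (linked_rot lk E ax)) (edgeC xb).
rewrite succ_notin // in ax.
(* Off [p], the vertex [x] is adjacent to both ends and would close a cycle through all of [p]. *)
suff lk2 : linked a x (rcons p x) by apply: no_long_cycle lk2 (edgeC ax).
split; rewrite ?size_rcons ?rcons_uniq ?xp //; last by lia.
by rewrite -cats1; apply: pathto_cat pp (edgeC xb) (pathto1 G x).
Qed.

Lemma shift_disj a b p : linked a b p -> [disjoint shift_nbrs p a & N b].
Proof. by move=> lk; apply: disjP => x xs; rewrite inE => /edgeC; apply: (linked_shift lk). Qed.

Lemma last_shift a b p : linked a b p -> b \notin shift_nbrs p a.
Proof.
move=> lk; have [pp Up Lp] := lk; rewrite inE; have [t E] := pathto_last pp.
by rewrite E succ_last -?E //; apply/negP/(linked_nadj lk).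
Qed.

Lemma linked_card a b p : linked a b p -> deg G a <= #|shift_nbrs p a|.
Proof. by move=> lk; have [pp Up Lp] := lk; apply: card_shift Up pp (linked_nadj lk). Qed.

(* [c] lists the cycle [C] cut open just after [w]. *)
Definition opened C w c :=
  [/\ pathto (next C w) w c, uniq c, c =i C, size c = size C
    & forall x, x \in C -> x != w -> succ_in c x = next C x].

Lemma next_cat C p x y (q : seq T) : uniq C -> C = p ++ x :: y :: q -> next C x = y.
Proof.
move=> UC E; rewrite next_nth E mem_cat !inE eqxx orbT /=.
have: uniq (p ++ x :: y :: q) by rewrite -E.
rewrite cat_uniq => /and3P[_ /= /norP[xp _] _].
case: p xp {E} => [|z p] /= xp; first by rewrite eqxx.
move: xp; rewrite inE => /norP[zx xp]; rewrite eq_sym (negbTE zx) index_cat (negbTE xp) /= eqxx addn0.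
by rewrite nth_cat ltnNge leqnSn /= subSnn.
Qed.

Lemma next_last y t w : uniq (y :: rcons t w) -> next (y :: rcons t w) w = y.
Proof.
rewrite cons_uniq mem_rcons inE rcons_uniq => /andP[/norP[yw yt] /andP[wt _]].
rewrite next_nth inE mem_rcons inE eqxx orbT /= (negbTE yw).
by rewrite -cats1 index_cat (negbTE wt) /= eqxx addn0 nth_default // size_cat addn1.
Qed.

Lemma ucycle_opened C w : ucycle e C -> w \in C -> 1 < size C -> exists c, opened C w c.
Proof.
move=> uC wC sC; have UC : uniq C by case/andP: uC.
have [i s E] := rot_to wC; case: s E => [|y t] E.
  by have := size_rot i C; rewrite E /=; lia.
have E1 : rot 1 (rot i C) = y :: rcons t w by rewrite E rot1_cons.
have U1 : uniq (y :: rcons t w) by rewrite -E1 !rot_uniq.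
have nE x : next (y :: rcons t w) x = next C x by rewrite -E1 !next_rot ?rot_uniq.
have wy : next C w = y by rewrite -nE next_last.
have cyc : cycle e (y :: rcons t w) by rewrite -E1 !rot_cycle; case/andP: uC.
exists (y :: rcons t w); split=> //.
- rewrite wy /= eqxx last_rcons eqxx andbT /=.
  by move: cyc; rewrite /= rcons_path => /andP[].
- by move=> x; rewrite -E1 !mem_rot.
- by rewrite -E1 !size_rot.
move=> x xC xw; have xc : x \in y :: rcons t w by rewrite -E1 !mem_rot.
case: (succ_split U1 xc) => [[r]|[s1 [s2 E2]]].
  by rewrite -rcons_cons => /rcons_inj[_ xE]; rewrite xE eqxx in xw.
by rewrite -nE (next_cat U1 E2).
Qed.


(** * Attachments of the vertices missed by a longest cycle *)

Definition longest C := ucycle e C /\ size C = L.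
Definition attW C h := N h :&: [set x in C].
Definition attO C h := N h :\: [set x in C].
Definition attY C h := [set next C w | w in attW C h].
(* On a longest cycle this has [deg G h] elements, and it is disjoint from the neighbourhood
   of each element of [attY C h], so it replaces the neighbourhood of [h] in degree counts. *)
Definition shadow C h := attY C h :|: attO C h.
(** For [h] off [C] this is its component in the graph minus [C]; for [h] on [C] it is [h] alone. *)
Definition comp C h := [set q | connect [rel x y | [&& e x y, x \notin C & y \notin C]] h q].

Lemma comp_refl C h : h \in comp C h.
Proof. by rewrite inE connect0. Qed.

Lemma comp_sym C h q : q \in comp C h -> h \in comp C q.
Proof.
rewrite !inE sym_connect_sym // => x y /=; rewrite edge_sym.
by case: (x \notin C); case: (y \notin C); rewrite ?andbF.
Qed.

Lemma comp_trans C h q r : q \in comp C h -> r \in comp C q -> r \in comp C h.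
Proof. by rewrite !inE; apply: connect_trans. Qed.

Lemma comp_edge C h r : h \notin C -> e h r -> r \notin C -> r \in comp C h.
Proof. by move=> hC hr rC; rewrite inE; apply: connect1 => /=; rewrite hr hC rC. Qed.

Lemma comp_out C h q : h \notin C -> q \in comp C h -> q \notin C.
Proof.
move=> hC; rewrite inE => /connectP[p pp ->].
by elim: p h hC pp => //= y p IH h hC /andP[/and3P[_ _ yC] pp]; apply: IH yC pp.
Qed.

Lemma comp_step C h q r : h \notin C -> q \in comp C h -> e q r -> r \notin C -> r \in comp C h.
Proof. by move=> hC qh qr rC; apply: comp_trans qh (comp_edge (comp_out hC qh) qr rC). Qed.

Lemma comp_path C h q : h \notin C -> q \in comp C h ->
  exists r, [/\ pathto h q r, uniq r & {subset r <= comp C h}].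
Proof.
move=> hC; rewrite inE => /connectP[p0 pp0 ->]; case/shortenP: pp0 => p pp Up _.
exists (h :: p); split=> //.
  by rewrite /= !eqxx andbT; apply: sub_path pp => x y /= /and3P[].
move=> x; rewrite inE => /orP[/eqP->|]; first exact: comp_refl.
elim: p h hC pp {Up} => [|y p IH] h hC //= /andP[/and3P[hy _ yC] pp].
have hy' := comp_edge hC hy yC.
rewrite inE => /orP[/eqP-> //|xp]; exact: comp_trans hy' (IH _ yC pp xp).
Qed.

Lemma longest_opened C w : longest C -> w \in C -> exists c, opened C w c.
Proof. by case=> uC sC wC; apply: ucycle_opened => //; rewrite sC; apply: ltnW. Qed.

Lemma longest_uniq C : longest C -> uniq C.
Proof. by case=> /andP[]. Qed.

(** The path outside [C] enters at [w] and runs backwards around all of [C], ending at the successor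
    of [w]. *)
Lemma ext_linked C w c a q r : longest C -> opened C w c -> pathto a q r -> uniq r ->
  (forall x, x \in r -> x \notin C) -> e q w -> linked a (next C w) (r ++ rev c).
Proof.
case=> _ sC [pc Uc cC szc _] pr Ur rC qw; split.
- exact: pathto_cat pr qw (pathto_rev pc).
- rewrite cat_uniq Ur rev_uniq Uc andbT; apply/hasPn=> x.
  by rewrite mem_rev cC; apply: contraL => /rC.
rewrite size_cat size_rev szc sC; have [t ->] := pathto_head pr; rewrite /=; lia.
Qed.

Lemma next_comp C h w q r : longest C -> h \notin C -> w \in C -> q \in comp C h -> e q w ->
  r \in comp C h -> ~ e (next C w) r.
Proof.
move=> lC hC wC qh qw rh; have [c oc] := longest_opened lC wC.
have [s [ps Us sC]] := comp_path (comp_out hC rh) (comp_trans (comp_sym rh) qh).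
apply: (no_long_cycle (ext_linked lC oc ps Us _ qw)) => x /sC.
exact: (comp_out (comp_out hC rh)).
Qed.

Lemma next_mem C w : (next C w \in C) = (w \in C).
Proof. exact: mem_next. Qed.

Lemma next_inj C : longest C -> {in C &, injective (next C)}.
Proof. by move/longest_uniq=> UC; apply: (can_in_inj (g := prev C)) => x _; apply: prev_next. Qed.

Lemma attWP C h w : w \in attW C h -> e h w /\ w \in C.
Proof. by rewrite !inE => /andP[]. Qed.

Lemma attOP C h q : q \in attO C h -> e h q /\ q \notin C.
Proof. by rewrite !inE => /andP[]. Qed.

Lemma attYP C h y : y \in attY C h -> exists w, [/\ e h w, w \in C & y = next C w].
Proof. by case/imsetP=> w /attWP[hw wC] ->; exists w. Qed.

Lemma attY_mem C h w : e h w -> w \in C -> next C w \in attY C h.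
Proof. by move=> hw wC; apply: imset_f; rewrite !inE hw. Qed.

Lemma attO_comp C h q : h \notin C -> q \in attO C h -> q \in comp C h.
Proof. by move=> hC /attOP[hq qC]; apply: comp_edge. Qed.

Lemma attY_C C h y : y \in attY C h -> y \in C.
Proof. by case/attYP=> w [_ wC ->]; rewrite next_mem. Qed.

Lemma card_attY C h : longest C -> #|attY C h| = #|attW C h|.
Proof.
move=> lC; apply: card_in_imset => x y /attWP[_ xC] /attWP[_ yC].
exact: next_inj.
Qed.

Lemma deg_att C h : deg G h = #|attW C h| + #|attO C h|.
Proof. by rewrite -[deg G h]/#|N h| -(cardsID [set x in C] (N h)). Qed.

Lemma YO_disj C h : [disjoint attY C h & attO C h].
Proof. by apply: disjP => x /attY_C xC /attOP[_]; rewrite xC. Qed.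

Lemma card_shadow C h : longest C -> #|shadow C h| = deg G h.
Proof. by move=> lC; rewrite cards_disjU ?YO_disj // card_attY // -deg_att. Qed.

(** An edge from [next C w] to the successor of another attachment, or to a vertex of the component,
    would close a cycle through all of [C] and more. *)
Lemma next_shadow C h w q : longest C -> h \notin C -> w \in C -> q \in comp C h -> e q w ->
  [disjoint shadow C h & N (next C w)].
Proof.
move=> lC hC wC qh qw; apply: disjP => x; rewrite [x \in N _]inE inE => /orP[|xO].
  case/attYP=> w' [hw' w'C xE] yx.
  case: (eqVneq w' w) => [ww|ww]; first by rewrite xE ww edge_irr in yx.
  have [c oc] := longest_opened lC wC.
  have [s [ps Us sC]] := comp_path hC qh.
  have sC' y : y \in s -> y \notin C by move/sC; apply: comp_out.
  have lk := ext_linked lC oc ps Us sC' qw.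
  apply: (linked_shift lk) (edgeC yx); rewrite inE.
  have [pc Uc cC szc nc] := oc; have w'c : w' \in c by rewrite cC.
  have := succ_split Uc w'c; rewrite nc // -xE => -[[t E]|[s1 [s2 E]]].
    by have [t' E'] := pathto_last pc; move: E; rewrite E' => /rcons_inj[_ E]; rewrite E eqxx in ww.
  (* This path traverses [C] backwards, so the successor of [x] on it is [w'], a neighbour of its
     first vertex [h]. *)
  have E2 : s ++ rev c = (s ++ rev s2) ++ x :: w' :: rev s1.
    by rewrite E rev_cat !rev_cons -!cats1 -!catA.
  by rewrite E2 succ_cat // -E2; case: lk.
by move/attO_comp: xO => /(_ hC); apply: next_comp lC hC wC qh qw.
Qed.

Lemma h_shadow C h : h \notin C -> h \notin shadow C h.
Proof.
move=> hC; rewrite inE; apply/norP; split; first by apply: contraNN hC => /attY_C.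
by apply/negP=> /attOP[]; rewrite edge_irr.
Qed.

Lemma shadow_ball C h v r : h \in M r v -> attY C h \subset M r.+1 v -> shadow C h \subset M r.+1 v.
Proof.
move=> hv Yv; rewrite subUset Yv; apply/subsetP=> x /attOP[hx _].
exact: ball_step hv hx.
Qed.

Lemma attY_ball C h v r : longest C -> h \in M r v -> attY C h \subset M r.+2 v.
Proof.
move=> [uC _] hv; apply/subsetP=> x /attYP[w [hw wC ->]].
apply: ball_step (ball_step hv hw) _.
by apply: next_cycle wC; case/andP: uC.
Qed.


(** * Configurations, and degree counts with the shadow of the missed vertex *)

Definition config C h := [/\ longest C, h \notin C & 1 < #|attW C h|].

(** The inequality is strict because [h] lies in the ball but in neither set. *)
Lemma shadow_count C h v (X : {set T}) : longest C -> h \notin C -> h \in M 2 v ->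
    attY C h \subset M 3 v -> X \subset M 3 v -> h \notin X -> [disjoint shadow C h & X] -> deg G h + #|X| < #|M 3 v|.
Proof.
move=> lC hC hv Yv Xv hX dX; rewrite -(card_shadow h lC) -cards_disjU //.
apply: (card_miss (x := h)); last by rewrite inE (negbTE hX) (negbTE (h_shadow hC)).
  by rewrite subUset Xv andbT; apply: shadow_ball hv Yv.
exact: ball_mono hv.
Qed.

Lemma degE x : deg G x = #|N x|. Proof. by []. Qed.

Lemma nbrsP x y : reflect (e x y) (y \in N x).
Proof. by rewrite inE; apply: idP. Qed.

Lemma notnbrs x y : ~ e x y -> x \notin N y.
Proof. by move=> xy; apply/nbrsP=> /edgeC. Qed.

Lemma disj_sym (A B : {set T}) : [disjoint A & B] -> [disjoint B & A].
Proof. by rewrite disjoint_sym. Qed.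

Lemma disjU (A B D : {set T}) : [disjoint A & B] -> [disjoint A & D] -> [disjoint A & B :|: D].
Proof.
move=> AB AD; apply: disjP => x xA; rewrite inE => /orP[] xB.
  by rewrite (disjointFr AB xA) in xB.
by rewrite (disjointFr AD xA) in xB.
Qed.

(** The shadow is disjoint from both neighbourhoods, so the excess of the degree sum over the size
    of the ball must be overlap of [N a] and [N b]. *)
Lemma common_nbrs C h v a b : longest C -> h \notin C -> attY C h \subset M 3 v ->
    h \in M 2 v -> a \in M 2 v -> b \in M 2 v -> h != a -> h != b -> a != b ->
    ~ e h a -> ~ e h b -> ~ e a b ->
    [disjoint shadow C h & N a] -> [disjoint shadow C h & N b] ->
  K v < #|N a :&: N b|.
Proof.
move=> lC hC Yv hv av bv ha hb ab nha nhb nab da db.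
have := deg_sum hv av bv ha ab hb nha nab nhb.
have : deg G h + #|N a :|: N b| < #|M 3 v|.
  apply: shadow_count lC hC hv Yv _ _ (disjU da db).
    by rewrite subUset !nbrs_ball.
  by rewrite inE; apply/norP; split; apply: notnbrs.
rewrite cardsU !degE; have := subset_leq_card (subsetIl (N a) (N b)); clear; lia.
Qed.

Lemma attY_shadow C h y : longest C -> h \notin C -> y \in attY C h ->
  [disjoint shadow C h & N y].
Proof. by move=> lC hC /attYP[w [hw wC ->]]; apply: next_shadow hw => //; apply: comp_refl. Qed.

Lemma attY_comp C h y q : longest C -> h \notin C -> y \in attY C h -> q \in comp C h -> ~ e y q.
Proof. by move=> lC hC /attYP[w [hw wC ->]]; apply: next_comp hw => //; apply: comp_refl. Qed.

Lemma attY_h C h y : longest C -> h \notin C -> y \in attY C h -> ~ e h y.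
Proof. by move=> lC hC yY /edgeC; apply: (attY_comp lC hC yY); apply: comp_refl. Qed.

Lemma attY_nadj C h y z : longest C -> h \notin C -> y \in attY C h -> z \in attY C h -> ~ e y z.
Proof.
move=> lC hC yY zY yz; have := disjointFr (attY_shadow lC hC yY) (x := z).
by rewrite !inE zY yz => /(_ isT).
Qed.

Lemma attY_neq C h y : h \notin C -> y \in attY C h -> h != y.
Proof. by move=> hC /attY_C yC; apply: contraNneq hC => ->. Qed.

Lemma attY2 C h y : longest C -> y \in attY C h -> y \in M 2 h.
Proof.
case=> uC _ /attYP[w [hw wC ->]]; apply: ball2_edges hw _.
by apply: next_cycle wC; case/andP: uC.
Qed.

Lemma attY_h2 C h y : longest C -> y \in attY C h -> h \in M 2 y.
Proof.
by move=> lC yY; have yh := attY2 lC yY; apply: (ball_sym _ yh); apply: ball_center yh.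
Qed.

Lemma attY_common C h y z v : longest C -> h \notin C ->
    y \in attY C h -> z \in attY C h -> y != z -> attY C h \subset M 3 v -> h \in M 2 v -> y \in M 2 v -> z \in M 2 v ->
  K v < #|N y :&: N z|.
Proof.
move=> lC hC yY zY yz Yv hv yv zv.
exact: (common_nbrs lC hC Yv hv yv zv (attY_neq hC yY) (attY_neq hC zY) yz
  (attY_h lC hC yY) (attY_h lC hC zY) (attY_nadj lC hC yY zY)
  (attY_shadow lC hC yY) (attY_shadow lC hC zY)).
Qed.

Lemma attY_dist C h y z : longest C -> h \notin C ->
  y \in attY C h -> z \in attY C h -> z \in M 2 y.
Proof.
move=> lC hC yY zY; have yh := attY2 lC yY; have zh := attY2 lC zY.
case: (eqVneq y z) => [->|yz]; first exact: ball_refl (ball_vert zh).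
have hh : h \in M 2 h by apply: ball_refl; apply: ball_center yh.
have Yh : attY C h \subset M 3 h by apply: (attY_ball (r := 1) lC); apply: ball_refl; apply: ball_center yh.
have := attY_common lC hC yY zY yz Yh hh yh zh.
case: (set_0Vmem (N y :&: N z)) => [->|[t]]; first by rewrite cards0.
by move=> /setIP[/nbrsP yt /nbrsP/edgeC zt] _; apply: ball2_edges yt zt.
Qed.

(** * Exchanging a missed vertex with a vertex of the cycle *)

Lemma split_last (P : pred T) (s : seq T) : has P s ->
  exists s1 x s2, [/\ s = rcons s1 x ++ s2, P x & ~~ has P s2].
Proof.
elim/last_ind: s => // s x IH; rewrite has_rcons; case: (boolP (P x)) => [Px _|nPx /= /IH].
  by exists s, x, [::]; rewrite cats0.
case=> s1 [y [s2 [-> Py s2P]]]; exists s1, y, (rcons s2 x).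
by rewrite rcons_cat has_rcons negb_or nPx.
Qed.

(** [wb] is the last attachment of [h] before [w] when [C] is traversed from the successor of
    [w]. *)
Lemma opened_split C h w c : opened C w c -> (exists2 u, u \in attW C h & u != w) ->
  exists A wb B, [/\ c = rcons A wb ++ B, pathto (next C w) wb (rcons A wb), pathto (next C wb) w B
    & [/\ wb \in attW C h, wb != w & forall x, x \in B -> x \in attW C h -> x = w]].
Proof.
case=> pc Uc cC szc nc [u uW uw]; have [hu uC] := attWP uW.
have [c' E] := pathto_last pc.
have uc' : has (mem (attW C h)) c'.
  by apply/hasP; exists u => //; move: uC; rewrite -cC E mem_rcons inE (negbTE uw).
have [A [wb [B [E' wbW BW]]]] := split_last uc'.
have EE : c = rcons A wb ++ rcons B w by rewrite E E' rcons_cat.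
have Bn : rcons B w != [::] by case: (B).
have An : rcons A wb != [::] by case: (A).
rewrite EE in pc; have [a [y [pA _ pB]]] := pathto_cat_inv An Bn pc.
have wbw : wb != w.
  by apply: contraTneq Uc => wbw; rewrite E E' wbw rcons_uniq mem_cat mem_rcons inE eqxx.
have nwb : next C wb = y.
  have [s2 EB] := pathto_head pB; rewrite -nc //; last by case: (attWP wbW).
  by rewrite EE EB cat_rcons succ_cat // -cat_rcons -EB -EE.
exists A, wb, (rcons B w); rewrite nwb; split=> //; last first.
  split=> // x; rewrite mem_rcons inE => /orP[/eqP //|xB] xW.
  by have := hasPn BW x xB; rewrite /= xW.
by have [t E1] := pathto_last pA; move: (congr1 (last wb) E1); rewrite !last_rcons => E2; rewrite -E2 in pA.
Qed.


Lemma succ_catl p b x (s : seq T) : uniq (rcons p b ++ s) -> x \in p ->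
  succ_in (rcons p b ++ s) x = succ_in (rcons p b) x.
Proof.
move=> U xp; case/splitPr: p / xp U => p1 p2 U.
have [y [t E]] : exists y t, rcons p2 b = y :: t by case: (p2) => [|y t]; [exists b, [::]|exists y, (rcons t b)].
move: U; rewrite rcons_cat rcons_cons E -catA /= => U.
by rewrite !succ_cat //; move: U; rewrite -cat_cons -cat_cons catA cat_uniq => /and3P[].
Qed.

Lemma succ_mem p b x : uniq (rcons p b) -> x \in p -> succ_in (rcons p b) x \in rcons p b.
Proof.
move=> U xp; have xb : x \in rcons p b by rewrite mem_rcons inE xp orbT.
case: (succ_split U xb) => [[t E]|[s1 [s2 E]]]; last by rewrite {2}E mem_cat !inE eqxx !orbT.
move: (congr1 (last b) E) U; rewrite !last_rcons => ->; rewrite rcons_uniq xp.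
by [].
Qed.

Lemma ucycle_pathto a b p : pathto a b p -> uniq p -> e b a -> ucycle e p.
Proof.
move=> pp Up ba; have [t E] := pathto_head pp; rewrite /ucycle Up andbT E /= rcons_path.
by move: pp; rewrite E => /and3P[_ -> /eqP->].
Qed.

(** [D] runs from [wa] back along [B], over [wb] back to [v], jumps to [o], goes forward to [w] and
    closes through [h]. It omits only [y] from [C]; the neighbours [v] and [w] of [y] are now
    followed by [o] and [h]. *)
Lemma exchange_cycle C h o wa wb y v w s1 s3 (B : seq T) : longest C -> h \notin C -> uniq C ->
    uniq ((s1 ++ w :: y :: v :: s3) ++ B) -> (s1 ++ w :: y :: v :: s3) ++ B =i C ->
    size ((s1 ++ w :: y :: v :: s3) ++ B) = size C -> pathto o wb (s1 ++ w :: y :: v :: s3) ->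
    pathto (next C wb) wa B -> e wb (next C wb) -> e h wa -> e h w -> e o v ->
  exists D, [/\ config D y, o \in attY D y & h \in attY D y].
Proof.
move=> lC hC UC U EC sC pA pB wb' hwa hw ov.
have [p1 p2] := pathto_split pA.
have [wy [yv p3]] : e w y /\ e y v /\ pathto v wb (v :: s3).
  by case/and3P: p2 => _ /= /and3P[-> -> p2] ->; rewrite !eqxx p2.
have p4 := pathto_cat p3 wb' pB.
have p5 : pathto wa h (rev ((v :: s3) ++ B) ++ rcons s1 w ++ [:: h]).
  by apply: pathto_cat (pathto_rev p4) (edgeC ov) (pathto_cat p1 (edgeC hw) (pathto1 G h)).
set D := rev _ ++ _ in p5.
have pD : perm_eq (y :: D) (h :: ((s1 ++ w :: y :: v :: s3) ++ B)).
  apply/permP=> P; rewrite /D /= !count_cat /= -!cats1 count_rev /= !count_cat /= !addn0.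
  move: (count P s1) (count P s3) (count P B) (P y) (P v) (P w) (P h); clear=> n1 n2 n3 b1 b2 b3 b4.
  lia.
have yD : uniq (y :: D).
  by rewrite (perm_uniq pD) /= U andbT EC.
have [yND UD] := andP yD.
have szD : size D = size C by have := perm_size pD; rewrite /= sC => -[].
have lD : longest D.
  by split; [apply: ucycle_pathto p5 UD hwa | rewrite szD; case: lC].
have [t Et] := pathto_head p1.
have Ev : D = rev (s3 ++ B) ++ v :: o :: (t ++ [:: h]).
  by rewrite /D Et /= rev_cons -cats1 -catA.
have Ew : D = (rev ((v :: s3) ++ B) ++ s1) ++ w :: h :: [::].
  by rewrite /D cat_rcons catA.
have vD : v \in D by rewrite Ev mem_cat inE eqxx orbT.
have wD : w \in D by rewrite Ew mem_cat inE eqxx orbT.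
have vw : v != w.
  move: U; rewrite -catA cat_uniq => /and3P[_ _ /=]; rewrite !inE !negb_or.
  by case/andP=> /and3P[_ wv _] _; rewrite eq_sym.
exists D; split.
- split=> //; have vW : v \in attW D y by rewrite !inE yv vD.
  have wW : w \in attW D y by rewrite !inE (edgeC wy) wD.
  by rewrite (cardsD1 v) vW (cardsD1 w) in_setD1 eq_sym vw wW.
- by rewrite -(next_cat UD Ev); apply: attY_mem.
by rewrite -(next_cat UD Ew); apply: attY_mem (edgeC wy) wD.
Qed.

(* [yb] starts the last stretch of the cycle without neighbours of [h].  Moving the
   neighbours of [o] one step along the path from [o] to [yb] through [h] keeps them inside
   the ball around [o]; the only overlap with the other two neighbourhoods comes from [Bad],
   whose members can be exchanged with [h] on the cycle. *)
Lemma exchange C h o : config C h -> o \in attY C h ->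
  exists yb (Bad : {set T}),
  [/\ yb \in attY C h, yb != o, K o <= #|Bad|.+1, K o < #|attW C h| &
   (forall y, y \in Bad -> [/\ y \in attY C h, y != o, y != yb,
      exists w, [/\ y = next C w, e h w, w \in C & e yb w] &
      exists D, [/\ config D y, o \in attY D y & h \in attY D y]]) /\
   (#|Bad| < K o -> forall z, z \in M 3 o -> ~ e yb z -> z \notin attY C h ->
      z \notin attW C h -> z \notin attO C h -> ~ e o z -> exists2 v, e o v & e v z)].
Proof.
case=> lC hC W2 oY; have [wa [hwa waC oE]] := attYP oY.
have [c oc] := longest_opened lC waC; have [pc Uc cC szc nc] := oc.
have waW : wa \in attW C h by rewrite !inE hwa.
have Wwa : exists2 u, u \in attW C h & u != wa.
  move: W2; rewrite (cardsD1 wa) waW ltnS => /card_gt0P[u /setD1P[uwa uW]].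
  by exists u.
have [A [wb [B [EAB pA pB [wbW wbwa BW]]]]] := opened_split oc Wwa.
have [hwb wbC] := attWP wbW.
set yb := next C wb in pB; rewrite -oE in pA.
have ybY : yb \in attY C h by apply: attY_mem.
have ybo : yb != o by rewrite oE (inj_in_eq (next_inj lC)) //.
have ohN : ~ e o h by move/edgeC; apply: attY_h lC hC oY.
have ybhN : ~ e yb h by move/edgeC; apply: attY_h lC hC ybY.
have oybN : ~ e o yb by apply: attY_nadj lC hC oY ybY.
(* From [o] forward to [wb], through [h] to [wa], then backwards to [yb]: this covers [C] and [h],
   hence has [L + 1] vertices. *)
pose p := rcons A wb ++ h :: rev B.
have UAB : uniq (rcons A wb ++ B) by rewrite -EAB.
have hAB : h \notin rcons A wb ++ B by rewrite -EAB cC.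
have Up : uniq p.
  have : perm_eq p (h :: (rcons A wb ++ B)).
    by rewrite /p perm_catC /= perm_cons perm_catC perm_cat2l perm_rev.
  by move/perm_uniq->; rewrite cons_uniq hAB.
have lk : linked o yb p.
  split=> //; first exact: pathto_cat pA (edgeC hwb) (pathto_cons hwa (pathto_rev pB)).
  by case: lC => _ <-; rewrite -szc EAB /p !size_cat /= size_rev addnS.
have nA x : x \in A -> succ_in p x = next C x.
  move=> xA; have xc : x \in C by rewrite -cC EAB mem_cat mem_rcons inE xA orbT.
  have xwa : x != wa.
    apply: contraTneq UAB => xwa; have [t ->] := pathto_last pB.
    apply/negP; rewrite cat_uniq => /and3P[_ /hasPn/(_ wa)].
    by rewrite !mem_rcons !inE eqxx -xwa xA orbT => /(_ isT).
  by rewrite -nc // EAB !succ_catl.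
have nwb : succ_in p wb = h by rewrite /p cat_rcons succ_cat // -cat_rcons.
have oG : o \in verts G by apply: ball_vert (attY2 lC oY).
have oM2 : o \in M 2 o by apply: ball_refl.
have YM2 y : y \in attY C h -> y \in M 2 o by apply: attY_dist.
have hM2 : h \in M 2 o := attY_h2 lC oY.
have WM3 w : w \in attW C h -> w \in M 3 o by case/attWP=> hw _; apply: ball_step hM2 hw.
have OM3 w : w \in attO C h -> w \in M 3 o by case/attOP=> hw _; apply: ball_step hM2 hw.
have s1M : shift_nbrs p o \subset M 3 o.
  by have [pp _ _] := lk; apply: (shift_ball (r := 1) Up pp); apply: ball_refl.
have s2M : N yb \subset M 3 o by apply: nbrs_ball; apply: YM2.
have d12 := shift_disj lk; have c1 := linked_card lk; have yb1 := last_shift lk.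
have d14 : [disjoint shift_nbrs p o & attO C h].
  apply: disjP => x; rewrite inE => ox xO; have [hx xC] := attOP xO.
  have xp : x \notin p.
    rewrite mem_cat inE mem_rev orbCA -mem_cat negb_or -EAB cC xC andbT.
    by apply: contraTneq hx => ->; rewrite edge_irr.
  rewrite succ_notin // in ox.
  by apply: (attY_comp lC hC oY) ox; apply: attO_comp.
have d24 : [disjoint N yb & attO C h].
  by apply: disjP => x; rewrite inE => ox /(attO_comp hC) xH; apply: (attY_comp lC hC ybY xH ox).
have nYO y x : y \in attY C h -> x \in attY C h -> ~ e y x by apply: attY_nadj.
have nhY y : y \in attY C h -> ~ e h y by apply: attY_h.

have AC x : x \in rcons A wb -> x \in C by move=> xA; rewrite -cC EAB mem_cat xA.
have UA : uniq (rcons A wb) by move: UAB; rewrite cat_uniq => /and3P[].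
have ybB : yb \in B by have [t ->] := pathto_head pB; rewrite inE eqxx.
have ABN x : x \in rcons A wb -> x \notin B.
  by move=> xA; apply: contraTN UAB => xB; rewrite cat_uniq !negb_and negbK; apply/orP; right;
    apply/orP; left; apply/hasP; exists x.
have waB : wa \in B by have [t ->] := pathto_last pB; rewrite mem_rcons inE eqxx.
have ybA x : x \in rcons A wb -> x != yb.
  by move/ABN; apply: contraNneq => ->.
(* [Dw] leaves out [wb], whose successor [yb] is treated separately. [Bad] collects the members of
   [Dy] that have the chord from [o] needed in [exchange_cycle]. *)
pose WA := attW C h :&: [set x in rcons A wb].
pose Dw := attW C h :&: [set x in A] :&: N yb.
pose Dy := [set next C w | w in Dw].
pose Bad := [set y in Dy | e o (next C y)].
have cW : #|attW C h| <= #|WA|.+1.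
  rewrite -add1n -(cards1 wa); apply: leq_trans (leq_card_setU _ _).
  apply/subset_leq_card/subsetP=> x xW; apply/setU1P.
  have: x \in rcons A wb ++ B by rewrite -EAB cC; case: (attWP xW).
  rewrite mem_cat => /orP[xA|/BW/(_ xW)]; last by left.
  by right; rewrite in_setI xW inE.
have cWA : #|WA :&: N yb| <= #|Dw|.+1.
  rewrite -add1n -(cards1 wb); apply: leq_trans (leq_card_setU _ _).
  apply/subset_leq_card/subsetP=> x; rewrite !inE mem_rcons inE.
  by case/andP=> /andP[-> /orP[->//|->]] ->; rewrite !orbT.
have cDy : #|Dy| = #|Dw|.
  apply: card_in_imset => x1 x2; rewrite !inE => /andP[/andP[/andP[_ x1C] _] _].
  by move=> /andP[/andP[/andP[_ x2C] _] _]; apply: next_inj.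
have DyP y : y \in Dy -> exists w, [/\ y = next C w, e h w, w \in A, e yb w & y \in A].
  case/imsetP=> w; rewrite !inE => /andP[/andP[/andP[hw wC] wA] ybw] yE; exists w; split=> //.
  have : succ_in (rcons A wb) w \in rcons A wb by apply: succ_mem.
  rewrite -(succ_catl (s := h :: rev B)) // nA // -yE mem_rcons inE => /orP[/eqP yw|//].
  by case: (nhY y); rewrite ?yw // -yw yE; apply: attY_mem.
have DyY y : y \in Dy -> y \in attY C h.
  by case/DyP=> w [-> hw wA _ _]; apply: attY_mem; rewrite // AC // mem_rcons inE wA orbT.
pose S3 := WA :\: N yb.
pose S6 := Dy :\: Bad.
have dYW : [disjoint attY C h & attW C h].
  by apply: disjP => x xY /attWP[hx _]; apply: (nhY x xY hx).
have dWO : [disjoint attW C h & attO C h].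
  by apply: disjP => x /attWP[_ xC] /attOP[_]; rewrite xC.
have S3P x : x \in S3 -> [/\ x \in attW C h, x \in rcons A wb & ~ e yb x].
  by rewrite in_setD in_setI => /and3P[/nbrsP ybx xW]; rewrite inE.
have S3W x : x \in S3 -> x \in attW C h by case/S3P.
have S6Y x : x \in S6 -> x \in Dy by rewrite inE => /andP[].
(* [V] replaces the neighbourhood of [h]: attachments adjacent to [yb] would meet [N yb] and are
   traded for their successors, except [Bad], which would meet the shifted neighbourhood of [o]. As
   [yb] makes up for [wb], at most [wa] and [#|Bad|] further elements are lost. *)
pose V := S3 :|: attO C h :|: (yb |: S6).
have ybS6 : yb \notin S6.
  by apply/negP=> /S6Y/DyP[w [_ _ _ _ yA]]; have := ybA yb; rewrite mem_rcons inE yA orbT eqxx => /(_ isT).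
have cV : #|V| = #|S3| + #|attO C h| + #|S6|.+1.
  rewrite cards_disjU; last first.
    apply: disjP => x; rewrite in_setU1 in_setU => xSO /orP[/eqP xE|/S6Y/DyY xY].
      by case/orP: xSO => [/S3W/attWP[hx _]|/attOP[hx _]]; apply: (nhY yb ybY); rewrite -xE.
    by case/orP: xSO => [/S3W/attWP[hx _]|/attOP[hx _]]; apply: (nhY x xY).
  rewrite cards_disjU ?cardsU1 ?ybS6 //.
  by apply: disjP => x /S3W xW xO; rewrite (disjointFr dWO xW) in xO.
have dUV : [disjoint shift_nbrs p o :|: N yb & V].
  apply: disj_sym; apply: disjP => x; rewrite !in_setU in_set1 => xV xU.
  case/orP: xV => [/orP[xS3|xO]|/orP[/eqP xE|xS6]].
  - have [xW xA xyb] := S3P x xS3; case/orP: xU => [|/nbrsP //].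
    rewrite inE; move: xA; rewrite mem_rcons in_cons => /orP[/eqP->|xA]; first by rewrite nwb.
    rewrite nA // => oy; apply: (nYO o (next C x) oY _ oy).
    by case/attWP: xW; apply: attY_mem.
  - by case/orP: xU => xU; [rewrite (disjointFr d14 xU) in xO|rewrite (disjointFr d24 xU) in xO].
  - by case/orP: xU => xU; [rewrite -xE xU in yb1|move: xU; rewrite xE inE edge_irr].
  have xY := DyY _ (S6Y _ xS6); have [w [xE hw wA ybw xA]] := DyP _ (S6Y _ xS6).
  case/orP: xU; last by move/nbrsP; apply: nYO.
  rewrite inE nA // => ox; move: xS6; rewrite in_setD => /andP[/negP xB xD].
  by apply: xB; rewrite inE xD.
have VM : V \subset M 3 o.
  apply/subsetP=> x; rewrite !in_setU in_set1 => /orP[/orP[/S3W/WM3|/OM3]|/orP[/eqP->|]] //.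
    exact: ball_mono (YM2 _ ybY).
  by move/S6Y/DyY=> xY; apply: ball_mono (YM2 _ xY).
have UVM : shift_nbrs p o :|: N yb :|: V \subset M 3 o by rewrite subUset VM subUset s1M s2M.
have cUV := cards_disjU dUV; rewrite (cards_disjU d12) cV in cUV.
have c3 := cardsID (N yb) WA; rewrite -/S3 in c3.
have c6 := cardsID Bad Dy; rewrite -/S6 in c6.
have BadDy : Bad \subset Dy by apply/subsetP=> x; rewrite inE => /andP[].
have sum := deg_sum hM2 oM2 (YM2 _ ybY) (attY_neq hC oY) _ (attY_neq hC ybY) (nhY o oY) oybN (nhY yb ybY).
rewrite eq_sym ybo in sum; move/(_ isT): sum => sum.
have cM := subset_leq_card UVM.
rewrite (setIidPr BadDy) in c6; rewrite (deg_att C h) [deg G yb]degE in sum.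
exists yb, Bad; split=> //.
- by move: sum cM c1 cUV c3 c6 cDy cWA cW; clear; lia.
- have cVO : #|shift_nbrs p o| + #|N yb| + #|attO C h| + 1 <= #|M 3 o|.
    apply: leq_trans cM; rewrite cUV; clear; lia.
  by move: sum cVO c1; clear; lia.
split.
  move=> y; rewrite inE => /andP[yDy oy]; have yY := DyY _ yDy.
  have [w [yE hw wA ybw yA]] := DyP _ yDy.
  have wA' : w \in rcons A wb by rewrite mem_rcons inE wA orbT.
  have yA' : y \in rcons A wb by rewrite mem_rcons inE yA orbT.
  split=> //.
  - apply: contraTneq waB => yo; apply: ABN.
    have -> // : wa = w by apply: (next_inj lC waC (AC _ wA')); rewrite -yE yo.
  - exact: ybA.
  - by exists w; split=> //; apply: AC.
  have [a1 [a2 EA]] : exists s1 s2, A = s1 ++ w :: s2.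
    by case/splitPr: (wA) => s1 s2; exists s1, s2.
  have [y0 [X EX]] : exists y0 X, rcons a2 wb = y0 :: X.
    by case: (a2) => [|y0 X]; [exists wb, [::] | exists y0, (rcons X wb)].
  have EAX : rcons A wb = a1 ++ w :: y0 :: X by rewrite EA rcons_cat rcons_cons EX.
  have Ep : p = a1 ++ w :: y0 :: (X ++ h :: rev B) by rewrite /p EAX -catA.
  have y0E : y0 = y by rewrite yE -nA // Ep succ_cat // -Ep.
  case: X => [|v s3] in EX EAX Ep.
    have := congr1 (last wb) EX; rewrite last_rcons /= y0E => wby.
    by case: (nhY y yY); rewrite -wby.
  have vE : v = next C y.
    have Ep' : p = (a1 ++ [:: w]) ++ y :: v :: (s3 ++ h :: rev B).
      by rewrite Ep y0E -catA.
    by rewrite -nA // Ep' succ_cat // -Ep'.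
  rewrite y0E in EAX; rewrite EAX in EAB pA.
  apply: (exchange_cycle (w := w) lC hC (longest_uniq lC) _ _ _ pA pB) => //; rewrite -?EAB //.
    by apply: next_cycle wbC; case: lC => /andP[].
  by rewrite vE.
move=> BadK z zM ybz zY zW zO oz.
(* Now [#|Bad|] is [K o - 1] and every estimate is tight, so the three sets fill the ball and [z]
   must lie in the shifted neighbourhood of [o]. *)
have EM : shift_nbrs p o :|: N yb :|: V = M 3 o.
  by apply/eqP; rewrite eqEcard UVM cUV; move: BadK sum cM c1 cUV c3 c6 cDy cWA cW; clear; lia.
move: zM; rewrite -EM !in_setU in_set1 (introF (nbrsP _ _) ybz) (negbTE zO) orbF.
case/orP=> [|/orP[/orP[/S3W|//]|/orP[/eqP zyb|/S6Y/DyY]]]; rewrite ?(negbTE zW) ?(negbTE zY) //.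
  2: by rewrite zyb ybY in zY.
rewrite inE => on; exists (succ_in p z) => //.
have [pp _ _] := lk; case: (succ_edge z Up pp) => [nz|/edgeC //].
by rewrite nz in on.
Qed.


(** * Further attachments of the component of a missed vertex *)

Lemma opened_prefix C w c A b (B : seq T) x : opened C w c -> c = rcons A b ++ B -> w \in B ->
  x \in A -> exists s1 s2, rcons A b = s1 ++ x :: next C x :: s2.
Proof.
case=> pc Uc cC szc nc E wB xA; have U : uniq (rcons A b ++ B) by rewrite -E.
have xR : x \in rcons A b by rewrite mem_rcons inE xA orbT.
have xw : x != w.
  apply: contraTneq U => xw; rewrite cat_uniq !negb_and negbK; apply/orP; right.
  by apply/orP; left; apply/hasP; exists w; rewrite //= -xw.
have nx : succ_in (rcons A b) x = next C x.
  by rewrite -nc // ?E ?succ_catl // -cC E mem_cat xR.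
have UA : uniq (rcons A b) by move: U; rewrite cat_uniq => /and3P[].
case: (succ_split UA xR) => [[t Et]|[s1 [s2]]]; last by rewrite nx; exists s1, s2.
have := congr1 (last b) Et; rewrite !last_rcons => bx.
by move: UA; rewrite rcons_uniq bx xA.
Qed.

Lemma next_edge C w : longest C -> w \in C -> e w (next C w).
Proof. by case=> /andP[cC _] _ wC; apply: next_cycle. Qed.

(* A detour through [h] and [q] absorbs two vertices, so no exchange as in [exchange] exists. *)
Lemma second_attachment C h q w1 : config C h -> q \in comp C h -> q != h -> w1 \in C -> e q w1 ->
  w1 \notin attW C h /\ (forall y, y \in attY C h -> next C w1 \notin M 2 y).
Proof.
move=> [lC hC W2] qh qNh w1C qw1; set y1 := next C w1.
have d1 : [disjoint shadow C h & N y1] := next_shadow lC hC w1C qh qw1.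
have y1h : ~ e y1 h := next_comp lC hC w1C qh qw1 (comp_refl C h).
have hy1 : h != y1 by apply: contraNneq hC => ->; rewrite next_mem.
have Yy1 y : y \in attY C h -> ~ e y y1.
  by move=> yY /edgeC/nbrsP yy1; have := disjointFr d1 (x := y); rewrite inE yY yy1 => /(_ isT).
suff key y0 : y0 \in attY C h -> y0 != y1 -> y1 \in M 2 y0 -> False.
  have w1W : w1 \notin attW C h.
    apply/negP=> w1W; move: W2; rewrite (cardsD1 w1) w1W ltnS => /card_gt0P[u /setD1P[uw1 uW]].
    have [hu uC] := attWP uW; have [hw1 _] := attWP w1W.
    apply: (key (next C u)); first exact: attY_mem.
      by rewrite (inj_in_eq (next_inj lC)).
    by apply: attY_dist lC hC _ _; apply: attY_mem.
  split=> // y yY; apply/negP=> yy1; have [w [hw wC yE]] := attYP yY.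
  apply: key yY _ yy1; rewrite yE (inj_in_eq (next_inj lC)) //.
  by apply: contraNneq w1W => <-; rewrite !inE hw.
move=> y0Y y0y1 y1y0.
have all2 y : y \in attY C h -> y != y1 -> y1 \in M 2 y.
  move=> yY yy1; have hy0 := attY_h2 lC y0Y.
  have Yy0 : attY C h \subset M 3 y0.
    by apply/subsetP=> x xY; apply: (ball_mono (r := 2)) => //; apply: attY_dist lC hC _ _.
  have := common_nbrs lC hC Yy0 hy0 (attY_dist lC hC y0Y yY) y1y0 (attY_neq hC yY) hy1 yy1
    (attY_h lC hC yY) (nedgeC y1h) (Yy1 y yY) (attY_shadow lC hC yY) d1.
  case: (set_0Vmem (N y :&: N y1)) => [->|[t]]; first by rewrite cards0.
  by move=> /setIP[/nbrsP yt /nbrsP/edgeC zt] _; apply: ball2_edges yt zt.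
have [c oc] := longest_opened lC w1C; have [pc Uc cC szc nc] := oc.
have Ww1 : exists2 u, u \in attW C h & u != w1.
  have /card_gt0P[u /setD1P[uw1 uW]] : 0 < #|attW C h :\ w1|.
    by have := cardsD1 w1 (attW C h); case: (w1 \in _); move: W2; clear; lia.
  by exists u.
have [A [wb [B [EAB pA pB [wbW wbw1 BW]]]]] := opened_split oc Ww1.
have [hwb wbC] := attWP wbW; set yb := next C wb in pB; rewrite -/y1 in pA.
have ybY : yb \in attY C h by apply: attY_mem.
have yby1 : yb != y1 by rewrite (inj_in_eq (next_inj lC)).
have y1yb := all2 yb ybY yby1.
have [r [pr Ur rH]] := comp_path hC qh.
have rC x : x \in r -> x \notin C by move/rH; apply: comp_out.
have r2 : 1 < size r.
  case: r pr {Ur rH rC} => [|x [|y r]] //= /andP[/eqP-> /eqP E].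
  by rewrite E eqxx in qNh.
have UAB : uniq (rcons A wb ++ B) by rewrite -EAB.
have UrAB : uniq (r ++ (rcons A wb ++ B)).
  rewrite -EAB cat_uniq Ur Uc andbT; apply/hasPn=> x; rewrite cC.
  by apply: contraL => /rC.
(* From [yb] forward to [w1], through the component from [q] to [h], then from [wb] backwards to
   [y1]. *)
pose p := B ++ rev r ++ rev (rcons A wb).
have lk : linked yb y1 p.
  split.
  - exact: pathto_cat pB (edgeC qw1) (pathto_cat (pathto_rev pr) hwb (pathto_rev pA)).
  - have : perm_eq p (r ++ (rcons A wb ++ B)).
      apply/permP=> P; rewrite /p !count_cat !count_rev; clear; lia.
    by move/perm_uniq->.
  have := szc; rewrite EAB /p !size_cat !size_rev; case: (lC) => _ ->.
  by move: r2; clear; lia.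
have Up : uniq p by case: lk.
have w1B : w1 \in B by have [t ->] := pathto_last pB; rewrite mem_rcons inE eqxx.
have ABN x : x \in rcons A wb -> x \notin B.
  by move=> xA; apply: contraTN UAB => xB; rewrite cat_uniq !negb_and negbK; apply/orP; right;
    apply/orP; left; apply/hasP; exists x.
have AC x : x \in A -> x \in C.
  by move=> xA; rewrite -cC EAB mem_cat mem_rcons inE xA orbT.
have Aw1 x : x \in A -> x != w1.
  by move=> xA; apply: contraTneq w1B => <-; apply: ABN; rewrite mem_rcons inE xA orbT.
have nA x : x \in A -> succ_in p (next C x) = x.
  move=> xA; have [s1 [s2 E]] := opened_prefix oc EAB w1B xA.
  have Ep : p = (B ++ rev r ++ rev s2) ++ next C x :: x :: rev s1.
    by rewrite /p E rev_cat !rev_cons -!cats1 -!catA.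
  by rewrite Ep succ_cat // -Ep.
have nYA x : x \in A -> e h x -> next C x \in A.
  move=> xA hx; have [s1 [s2 E]] := opened_prefix oc EAB w1B xA.
  have : next C x \in rcons A wb by rewrite E mem_cat !inE eqxx !orbT.
  rewrite mem_rcons inE => /orP[/eqP xb|//].
  by case: (attY_h lC hC (attY_mem hx (AC x xA))); rewrite xb.
have WAP x : x \in attW C h :&: [set x in A] -> e h x /\ x \in A.
  by rewrite in_setI [x \in [set y in _]]inE => /andP[/attWP[]].
have y1far x : x \in A -> e h x -> ~ e y1 (next C (next C x)).
  move=> xA hx; have yA := nYA x xA hx.
  have [s1 [s2 E]] := opened_prefix oc EAB w1B xA.
  have [t1 [t2 E']] := opened_prefix oc EAB w1B yA.
  have UA : uniq (rcons A wb) by move: UAB; rewrite cat_uniq => /and3P[].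
  have := succ_cat (p := t1) (x := next C x) (y := next C (next C x)) (q := t2); rewrite -E' => /(_ UA).
  case: s2 => [|v s3] in E *.
    have : rcons A wb = rcons (rcons s1 x) (next C x) by rewrite E -!cats1 -catA.
    move/(congr1 (last wb)); rewrite !last_rcons => xb.
    by case: (attY_h lC hC (attY_mem hx (AC x xA))); rewrite -xb.
  have E2 : rcons A wb = (s1 ++ [:: x]) ++ next C x :: v :: s3 by rewrite E -catA.
  rewrite E2 succ_cat -?E2 // => <- y1v.
  rewrite E in pA; have [p1 p2] := pathto_split pA.
  have p3 : pathto v wb (v :: s3).
    by case/and3P: p2 => _ /= /and3P[_ _ p2] ->; rewrite !eqxx p2.
  (* This path leaves out only the successor of [x] on [C], which the two or more vertices of [r]
     outweigh. *)
  suff lk2 : linked y1 v (rcons s1 x ++ r ++ rev ((v :: s3) ++ B)) by apply: (linked_nadj lk2).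
  split.
  - apply: pathto_cat p1 (edgeC hx) (pathto_cat pr qw1 _).
    by apply: pathto_rev; apply: pathto_cat p3 (next_edge lC wbC) pB.
  - have pe : perm_eq (next C x :: rcons s1 x ++ r ++ rev ((v :: s3) ++ B)) (r ++ (rcons A wb ++ B)).
      apply/permP=> P; rewrite E -cats1 /= !count_cat count_rev /= !count_cat /= !addn0.
      move: (count P s1) (count P s3) (count P B) (count P r) (P x) (P v) (P (next C x)).
      by clear; lia.
    by move: UrAB; rewrite -(perm_uniq pe) => /andP[].
  have := szc; rewrite EAB E; case: (lC) => _ ->.
  rewrite !size_cat size_rev size_rcons /= !size_cat /=; move: r2; clear; lia.
pose Wd := attW C h :&: [set x in A].
(* On [p] the successor of [next C x] is [x]. If [x] is adjacent to [yb], then [next C x] lies in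
   the shifted neighbourhood of [yb], so such an [x] is moved two steps. *)
pose E1 := [set next C x | x in Wd :\: N yb].
pose E2 := [set next C (next C x) | x in Wd :&: N yb].
have cW : #|attW C h| <= #|Wd| + 2.
  have : attW C h \subset Wd :|: [set wb; w1].
    apply/subsetP=> x xW; have: x \in rcons A wb ++ B by rewrite -EAB cC; case: (attWP xW).
    rewrite mem_cat mem_rcons inE in_setU in_set2 => /orP[/orP[->|xA]|/BW/(_ xW)->]; rewrite ?eqxx ?orbT //.
    by rewrite in_setI xW inE xA.
  move/subset_leq_card/leq_trans; apply; apply: leq_trans (leq_card_setU _ _) _.
  by rewrite leq_add2l cards2; case: (_ != _).
have WdC x : x \in Wd -> x \in C by case/WAP=> _ /AC.
have cE1 : #|E1| = #|Wd :\: N yb|.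
  apply: card_in_imset => x1 x2 /setDP[/WdC x1C _] /setDP[/WdC x2C _].
  exact: next_inj.
have cE2 : #|E2| = #|Wd :&: N yb|.
  apply: card_in_imset => x1 x2 /setIP[/WdC x1C _] /setIP[/WdC x2C _] E.
  by apply: (next_inj lC x1C x2C); apply: (next_inj lC _ _ E); rewrite next_mem.
have E1P x : x \in E1 -> exists w, [/\ w \in A, e h w, ~ e yb w & x = next C w].
  by case/imsetP=> w /setDP[/WAP[hw wA] /nbrsP ybw] ->; exists w.
have E2P x : x \in E2 -> exists w, [/\ w \in A, e h w & x = next C (next C w)].
  by case/imsetP=> w /setIP[/WAP[hw wA] _] ->; exists w.
have WY w : w \in A -> e h w -> next C w \in attY C h by move=> /AC wC hw; apply: attY_mem.
have d12 : [disjoint E1 & E2].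
  apply: disjP => x /E1P[w [wA hw _ xE]] /E2P[w' [wA' hw' xE']].
  have ww : w = next C w' by apply: (next_inj lC); rewrite ?next_mem ?AC // -xE.
  by apply: (attY_h lC hC (WY w' wA' hw')); rewrite -ww.
have E12C x : x \in E1 :|: E2 -> x \in C.
  by rewrite inE => /orP[/E1P[w [/AC wC _ _ ->]]|/E2P[w [/AC wC _ ->]]]; rewrite !next_mem.
have dEO : [disjoint E1 :|: E2 & attO C h].
  by apply: disjP => x /E12C xC /attOP[_]; rewrite xC.
pose V := E1 :|: E2 :|: attO C h.
have ybM : yb \in M 2 yb by apply: ball_refl; apply: ball_center y1yb.
have dV : [disjoint shift_nbrs p yb :|: N y1 & V].
  apply: disjP => x xU; rewrite in_setU in_setU => xV.
  have {}xU : e yb (succ_in p x) || e y1 x by move: xU; rewrite !inE.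
  case/orP: xV => [/orP[/E1P[w [wA hw ybw xE]]|/E2P[w [wA hw xE]]]|xO].
  - case/orP: xU => xU; first by apply: ybw; rewrite xE nA // in xU.
    by apply: (Yy1 x); [rewrite xE; apply: WY | apply: edgeC].
  - case/orP: xU => xU; last by apply: (y1far w wA hw); rewrite -xE.
    rewrite xE nA ?nYA // in xU; exact: attY_nadj lC hC ybY (WY w wA hw) xU.
  have xH := attO_comp hC xO; have [hx xC] := attOP xO.
  case/orP: xU => xU; last by apply: (next_comp lC hC w1C qh qw1 xH).
  have Ep : p = B ++ rev r ++ wb :: rev A by rewrite /p rev_rcons.
  case: (boolP (x \in p)) => xp; last first.
    by rewrite succ_notin // in xU; apply: (attY_comp lC hC ybY xH).
  have xr : x \in rev r.
    move: xp; rewrite !mem_cat [x \in rev (rcons _ _)]mem_rev orbCA -mem_cat.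
    case/orP=> [//|]; rewrite mem_cat orbC -mem_cat -EAB cC => xC'.
    by rewrite xC' in xC.
  have := succ_block (s1 := B) (y := wb) (s2 := rev A) _ xr; rewrite -Ep => /(_ Up) [xr'|[[r' rE] _]].
    by apply: (attY_comp lC hC ybY _ xU); apply: rH; rewrite -mem_rev.
  have [t tE] := pathto_last (pathto_rev pr); move: (congr1 (last h) tE); rewrite rE !last_rcons => xh.
  by rewrite xh edge_irr in hx.
have UVM : shift_nbrs p yb :|: N y1 :|: V \subset M 3 yb.
  have [pp _ _] := lk.
  rewrite subUset subUset (shift_ball (r := 1) Up pp) ?nbrs_ball //=; last first.
    by apply: ball_refl; apply: ball_center y1yb.
  apply/subsetP=> x; rewrite in_setU in_setU => /orP[/orP[/E1P[w [wA hw _ ->]]|/E2P[w [wA hw ->]]]|/attOP[hx _]].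
  - by apply: ball_mono (attY_dist lC hC ybY (WY w wA hw)).
  - apply: ball_step (attY_dist lC hC ybY (WY w wA hw)) (next_edge lC _).
    by rewrite next_mem AC.
  exact: ball_step (attY_h2 lC ybY) hx.
have y1U : y1 \notin shift_nbrs p yb :|: N y1 :|: V.
  rewrite in_setU in_setU negb_or negb_or (last_shift lk) /= inE edge_irr /= in_setU negb_or in_setU negb_or.
  rewrite -andbA; apply/and3P; split; apply/negP.
  - case/E1P=> w [wA _ _ wE]; have := Aw1 w wA.
    by rewrite (next_inj lC w1C (AC w wA) wE) eqxx.
  - case/E2P=> w [wA hw wE]; have := Aw1 _ (nYA w wA hw).
    by rewrite -(next_inj lC w1C _ wE) ?next_mem ?AC // eqxx.
  by case/attOP=> _; rewrite next_mem w1C.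
have := card_miss UVM (ball_mono (r := 2) (s := 3) isT y1yb) y1U.
rewrite (cards_disjU dV) (cards_disjU (shift_disj lk)) (cards_disjU dEO) (cards_disjU d12) cE1 cE2.
have c3 := cardsID (N yb) Wd.
have := deg_sum (attY_h2 lC ybY) ybM y1yb (attY_neq hC ybY) yby1 hy1 (attY_h lC hC ybY)
   (Yy1 yb ybY) (nedgeC y1h).
rewrite (deg_att C h) [deg G y1]degE.
(* At most [wb] and [w1] are lost from the neighbours of [h], and [y1] is left uncounted, so [K yb]
   would be at most one. *)
move: (K_ge2 (ball_center y1yb)) (linked_card lk) cW c3; clear; lia.
Qed.


(** * Centres of minimal connectivity *)

Definition is_center o := exists C h, config C h /\ o \in attY C h.
Definition minimal o := forall v, is_center v -> K o <= K v.

Lemma config_exchange C h o : config C h -> o \in attY C h -> exists yb (Bad : {set T}) y,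
  [/\ y \in Bad, y \in attY C h, exists w, [/\ y = next C w, e h w, w \in C & e yb w] &
      exists D, [/\ config D y, o \in attY D y & h \in attY D y]].
Proof.
move=> cC oY; have [yb [Bad [_ _ cB _ [BadP _]]]] := exchange cC oY.
have oG : o \in verts G by apply: (ball_vert (attY2 _ oY)); case: cC.
have /card_gt0P[y yB] : 0 < #|Bad| by move: cB (K_ge2 oG); clear; lia.
by exists yb, Bad, y; have [? _ _ ? ?] := BadP y yB.
Qed.

(** Describes a vertex beyond a minimum cut when no vertex there is within distance two of [o]: it
    need not be interior, and its neighbours counted here all lie in the cut. *)
Definition on_rim C h o z := [/\ z \in M 3 o, z \notin M 2 o, ~ e h z
  & #|N z :&: (M 2 o :|: attO C h)| <= K o].

(** Otherwise the degree condition for [h], [o], [z] around [v] forces an overlap larger than [K v],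
    whereas at most [K o] is possible; but [v] is a centre too. *)
Lemma rim_far C h o z v : config C h -> o \in attY C h -> minimal o -> on_rim C h o z ->
  v = h \/ v \in attY C h -> z \notin M 2 v.
Proof.
move=> cC oY omin [z3 z2 hz zK] vE; have [lC hC W2] := cC.
have [yb [Bad [y [_ _ _ [D [cD _ hD]]]]]] := config_exchange cC oY.
(* An exchange makes [h] a centre: it becomes the successor of a neighbour of the newly missed
   [y]. *)
have vc : is_center v by case: vE => [->|vY]; [exists D, y | exists C, h].
apply/negP=> zv; have := omin v vc; apply/negP; rewrite -ltnNge.
have hv : h \in M 2 v by case: vE => [vh|]; [rewrite -vh; apply: ball_refl (ball_center zv)|apply: attY_h2].
have ov : o \in M 2 v by case: vE => [->|vY]; [apply: attY2 lC oY | apply: attY_dist lC hC vY oY].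
have Yv : attY C h \subset M 3 v.
  case: vE => [vh|vY]; first by apply: (attY_ball (r := 1) lC); rewrite vh ball_refl // -vh (ball_center zv).
  by apply/subsetP=> x xY; apply: (ball_mono (r := 2)) => //; apply: attY_dist lC hC _ _.
have oz : ~ e o z by move=> oz; case/negP: z2; apply: ball_mono (ball1_edge oz).
have hoz : h != z by apply: contraNneq z2 => <-; apply: attY_h2 lC oY.
have oz' : o != z by apply: contraNneq z2 => <-; apply: ball_refl; apply: ball_center z3.
have dh := attY_shadow lC hC oY.
have UM : shadow C h :|: N o :|: N z \subset M 3 v.
  by rewrite !subUset !nbrs_ball // !andbT -subUset; apply: shadow_ball hv Yv.
have hU : h \notin shadow C h :|: N o :|: N z.
  apply/negP=> /setUP[/setUP[|/nbrsP/edgeC]|/nbrsP/edgeC] //; last exact: attY_h lC hC oY.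
  exact/negP/h_shadow.
have := card_miss UM (ball_mono (r := 2) (s := 3) isT hv) hU.
rewrite cardsU (cards_disjU dh) (card_shadow _ lC).
have sub : (shadow C h :|: N o) :&: N z \subset N z :&: (M 2 o :|: attO C h).
  apply/subsetP=> x /setIP[xU xz]; rewrite in_setI xz in_setU.
  case/setUP: xU => [/setUP[xY|->]|/nbrsP ox]; rewrite ?orbT //.
    by rewrite (attY_dist lC hC oY xY).
  by rewrite (ball_mono (r := 1)) // ball1_edge.
have := deg_sum hv ov zv (attY_neq hC oY) oz' hoz (attY_h lC hC oY) oz hz.
rewrite [deg G o]degE [deg G z]degE.
have := subset_leq_card (subsetIr (shadow C h :|: N o) (N z)).
move: (subset_leq_card sub) zK; clear; lia.
Qed.

Lemma ball2_common v x t : e v t -> e x t -> x \in M 2 v.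
Proof. by move=> vt /edgeC; apply: ball2_edges vt. Qed.

Lemma rim_no_common C h o z s : config C h -> o \in attY C h -> minimal o -> on_rim C h o z ->
  s \in M 2 o -> e s z -> forall x, e s x -> ~ e h x.
Proof.
move=> cC oY omin rz so sz x sx hx; have [lC hC W2] := cC; have [z3 z2 hz zK] := rz.
have zh : z \notin M 2 h by apply: rim_far cC oY omin rz _; left.
have zY y : y \in attY C h -> z \notin M 2 y by move=> yY; apply: rim_far cC oY omin rz _; right.
have oG := ball_center z3.
(* For [x] on [C], the vertices [h], [next C x], [z] violate the degree condition around [x]: the
   shadow and the two neighbourhoods are pairwise disjoint. *)
case: (boolP (x \in C)) => xC.
  have yY := attY_mem hx xC; set y := next C x in yY; have zy := zY y yY.
  have xh1 : h \in M 1 x := ball1_edge (edgeC hx).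
  have xh : h \in M 2 x := ballW xh1.
  have xy : y \in M 2 x := ballW (ball1_edge (next_edge lC xC)).
  have xz : z \in M 2 x := ball2_edges (edgeC sx) sz.
  have yz : ~ e y z by move=> yz; case/negP: zy; apply: ball_mono (ball1_edge yz).
  have dh : [disjoint shadow C h & N y :|: N z].
    apply: disjU; first exact: attY_shadow.
    apply: disjP => u /setUP[uY|/attOP[hu _]] /nbrsP zu.
      by case/negP: (zY u uY); apply: ball_mono (ball1_edge (edgeC zu)).
    by case/negP: zh; apply: ball2_common hu zu.
  have dyz : [disjoint N y & N z].
    by apply: disjP => u /nbrsP yu /nbrsP zu; case/negP: zy; apply: ball2_common yu zu.
  have XM : N y :|: N z \subset M 3 x by rewrite subUset !nbrs_ball.
  have hX : h \notin N y :|: N z.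
    by rewrite in_setU negb_or (notnbrs hz) (notnbrs (attY_h lC hC yY)).
  have := shadow_count lC hC xh (attY_ball (r := 1) lC xh1) XM hX dh.
  have yz' : y != z by apply: contraNneq zy => <-; apply: ball_refl; apply: ball_vert xy.
  have hz' : h != z by apply: contraNneq zh => <-; apply: ball_refl; apply: ball_vert xh.
  have := deg_sum xh xy xz (attY_neq hC yY) yz' hz' (attY_h lC hC yY) yz hz.
  rewrite (cards_disjU dyz) [deg G y]degE [deg G z]degE; clear; lia.
have xH : x \in comp C h := comp_edge hC hx xC.
have xh : x != h by apply: contraTneq hx => ->; rewrite edge_irr.
(* With [s] off [C], both [x] and [s] are in the component of [h], and a vertex of [C] joining [s]
   to [o] would be a second attachment too close to [o]. *)
case: (boolP (s \in C)) => sC; last first.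
  have sH := comp_step hC xH (edgeC sx) sC.
  have snh : s != h by apply: contraPneq sz => ->.
  case: (ball2P so) => [sE|os|[t ot ts]].
  - by rewrite sE (attY_C oY) in sC.
  - exact: (attY_comp lC hC oY sH os).
  case: (boolP (t \in C)) => tC; last first.
    exact: (attY_comp lC hC oY (comp_step hC sH (edgeC ts) tC) ot).
  have [_ /(_ o oY)/negP] := second_attachment cC sH snh tC (edgeC ts); apply.
  exact: ball2_edges ot (next_edge lC tC).
(* Here [s] is itself a second attachment, so its successor [y] is far from [o], and [x], [o], [y]
   violate the degree condition around [s]. *)
have [_ far] := second_attachment cC xH xh sC (edgeC sx).
set y := next C s in far; have yo := far o oY.
have os : o \in M 2 s by apply: ball_sym so.
have sx1 : x \in M 1 s := ball1_edge sx.
have sx2 : x \in M 2 s := ballW sx1.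
have sy : y \in M 2 s := ballW (ball1_edge (next_edge lC sC)).
have ox : ~ e o x := attY_comp lC hC oY xH.
have yx : ~ e y x := next_comp lC hC sC xH (edgeC sx) xH.
have oy : ~ e o y by move=> oy; case/negP: yo; apply: ball_mono (ball1_edge oy).
have doy : [disjoint N o & N y].
  by apply: disjP => u /nbrsP ou /nbrsP yu; case/negP: yo; apply: ball2_common ou yu.
have dx : [disjoint shadow C x & N o :|: N y].
  apply: disjU; last exact: next_shadow lC xC sC (comp_refl C x) (edgeC sx).
  apply: disjP => u /setUP[/attYP[w [xw wC ->]]|/(attO_comp xC) ux] /nbrsP ou.
    have [_ /(_ o oY)/negP] := second_attachment cC xH xh wC xw; apply.
    exact: ball_mono (ball1_edge ou).
  exact: (attY_comp lC hC oY (comp_trans xH ux) ou).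
have XM : N o :|: N y \subset M 3 s by rewrite subUset !nbrs_ball.
have xX : x \notin N o :|: N y by rewrite in_setU negb_or !notnbrs // => /edgeC.
have := shadow_count lC xC sx2 (attY_ball (r := 1) lC sx1) XM xX dx.
have xo : x != o by apply: contraNneq xC => ->; apply: attY_C oY.
have xy : x != y by apply: contraNneq xC => ->; rewrite next_mem.
have oy' : o != y by apply: contraNneq yo => <-; apply: ball_refl.
have := deg_sum sx2 os sy xo oy' xy (nedgeC ox) oy (nedgeC yx).
rewrite (cards_disjU doy) [deg G o]degE [deg G y]degE; clear; lia.
Qed.

(** Otherwise the shadow of [h] and the neighbourhoods of [y] and [s] are pairwise disjoint, too
    many vertices for the ball around [o]. *)
Lemma rim_common C h o z s y : config C h -> o \in attY C h -> minimal o -> on_rim C h o z ->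
  s \in M 2 o -> e s z -> y \in attY C h -> exists2 t, e s t & e y t.
Proof.
move=> cC oY omin rz so sz yY; have [lC hC W2] := cC; have [z3 z2 hz zK] := rz.
have zh : z \notin M 2 h by apply: rim_far cC oY omin rz _; left.
have zY u : u \in attY C h -> z \notin M 2 u by move=> uY; apply: rim_far cC oY omin rz _; right.
have nohs := rim_no_common cC oY omin rz so sz.
case: (set_0Vmem (N y :&: N s)) => [Ns0|[t /setIP[/nbrsP yt /nbrsP st]]]; last by exists t.
have hs : ~ e h s by move=> hs; case/negP: zh; apply: ball2_edges hs sz.
have ys u : u \in attY C h -> ~ e u s.
  by move=> uY us; case/negP: (zY u uY); apply: ball2_edges us sz.
have dh : [disjoint shadow C h & N y :|: N s].
  apply: disjU; first exact: attY_shadow.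
  apply: disjP => u /setUP[uY|/attOP[hu _]] /nbrsP su; first by apply: (ys u uY); apply: edgeC.
  exact: nohs su hu.
have ho := attY_h2 lC oY; have yo := attY_dist lC hC oY yY.
have XM : N y :|: N s \subset M 3 o by rewrite subUset !nbrs_ball.
have hX : h \notin N y :|: N s.
  by rewrite in_setU negb_or (notnbrs hs) (notnbrs (attY_h lC hC yY)).
have Yo : attY C h \subset M 3 o.
  by apply/subsetP=> x xY; apply: (ball_mono (r := 2)) => //; apply: attY_dist lC hC _ _.
have := shadow_count lC hC ho Yo XM hX dh.
have hs' : h != s by apply: contraPneq hz => ->.
have ys' : y != s.
  by apply: contraNneq (zY y yY) => ->; apply: ball_mono (ball1_edge sz).
have := deg_sum ho yo so (attY_neq hC yY) ys' hs' (attY_h lC hC yY) (ys y yY) hs.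
rewrite cardsU Ns0 cards0 [deg G y]degE [deg G s]degE; clear; lia.
Qed.

(* For a neighbour [s] of [z] inside the ball, [s] has no common neighbour with the missed
   vertex [h] but has one with each successor, and [h] can be exchanged for a successor. *)
Lemma no_rim C h o z : config C h -> o \in attY C h -> minimal o -> ~ on_rim C h o z.
Proof.
move=> cC oY omin rz; have [z3 z2 hz zK] := rz.
have [yb [Bad [y [_ yY _ [D [cD oD hD]]]]]] := config_exchange cC oY.
have zy : z \notin M 2 y by apply: rim_far cC oY omin rz _; right.
have [s so sz] : exists2 s, s \in M 2 o & e s z.
  by case: (ball_last z3) => // zo; rewrite zo in z2.
have [t st yt] := rim_common cC oY omin rz so sz yY.
(* Being far from [y], the vertex [z] has no neighbour in [attO D y], so it is on the rim for
   [(D, y)] too; there [t] is a forbidden common neighbour of [s] and [y]. *)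
apply: (rim_no_common cD oD omin _ so sz st yt); split=> //.
  by move=> yz; case/negP: zy; apply: ball_mono (ball1_edge yz).
apply: leq_trans zK; apply/subset_leq_card/subsetP=> x /setIP[zx /setUP[xo|/attOP[yx _]]].
  by rewrite in_setI zx in_setU xo.
by case/negP: zy; apply: ball2_common yx _; apply/nbrsP.
Qed.

Lemma missed_in_cut C h o S : config C h -> o \in attY C h -> minimal o ->
  separates G o S -> h \in S.
Proof.
move=> cC oY omin [SM SK Ssep]; have [lC hC W2] := cC.
case: (boolP (h \in S)) => // hS; exfalso.
have ho := attY_h2 lC oY.
have h3 : h \in M 3 o :\: S by rewrite in_setD hS (ball_mono (r := 2)).
have [B1 [B2 [hB1 [z0 z0B2] EB dB noB]]] := Ssep h h3.
have Bcase x : x \in M 3 o -> [\/ x \in S, x \in B1 | x \in B2].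
  move=> xM; case: (boolP (x \in S)) => xS; first by constructor 1.
  have : x \in B1 :|: B2 by rewrite EB in_setD xS.
  by case/setUP; [constructor 2|constructor 3].
have YM y : y \in attY C h -> y \in M 2 o by apply: attY_dist.
have Yo : attY C h \subset M 3 o by apply/subsetP=> x /YM; apply: ball_mono.
have WM w : w \in attW C h -> w \in M 3 o by case/attWP=> hw _; apply: ball_step ho hw.
(* Otherwise each attachment outside [S] lies in [B1] and has its successor in [S]. With the
   attachments in [S] this packs more than [K o] vertices into [S]. *)
have [yi yiY yiB1] : exists2 y, y \in attY C h & y \in B1.
  case: (set_0Vmem (attY C h :&: B1)) => [YB0|[y /setIP[]]]; last by exists y.
  have [yb [Bad [_ _ _ KW _]]] := exchange cC oY; exfalso.
  have cWS : #|attW C h :\: S| <= #|attY C h :&: S|.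
    rewrite -(card_in_imset (f := next C) (D := attW C h :\: S)); last first.
      by move=> x y /setDP[/attWP[_ xC] _] /setDP[/attWP[_ yC] _]; apply: next_inj.
    apply/subset_leq_card/subsetP=> _ /imsetP[w /setDP[wW wS] ->].
    have [hw wC] := attWP wW; have yY := attY_mem hw wC; rewrite in_setI yY /=.
    have wB1 : w \in B1.
      case: (Bcase w (WM w wW)) => // [wS'|wB2]; first by rewrite wS' in wS.
      by case: (noB h w hB1 wB2).
    case: (Bcase _ (subsetP Yo _ yY)) => // yB.
      by have := in_set0 (next C w); rewrite -YB0 in_setI yY yB.
    by case: (noB w _ wB1 yB); apply: next_edge.
  have dWY : [disjoint attW C h :&: S & attY C h :&: S].
    by apply: disjP => x /setIP[/attWP[hx _] _] /setIP[xY _]; apply: (attY_h lC hC xY).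
  have : #|(attW C h :&: S) :|: (attY C h :&: S)| <= #|S|.
    by apply/subset_leq_card; rewrite subUset !subsetIr.
  rewrite (cards_disjU dWY) SK; have := cardsID S (attW C h).
  move: KW cWS; clear; lia.
(* Two successors have more than [#|S|] common neighbours, so one of these avoids [S] and would join
   the two sides. *)
have YB2 y : y \in attY C h -> y \notin B2.
  move=> yY; apply/negP=> yB2.
  have yyi : y != yi by apply: contraTneq yB2 => ->; rewrite (disjointFr dB yiB1).
  have := attY_common lC hC yY yiY yyi Yo ho (YM y yY) (YM yi yiY); rewrite -SK => cK.
  have [t /setIP[/nbrsP yt /nbrsP yit] tS] : exists2 t, t \in N y :&: N yi & t \notin S.
    by apply/subsetPn; apply: contraL cK => /subset_leq_card; rewrite -leqNgt.
  have t3 := ball_step (YM y yY) yt.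
  case: (Bcase t t3) => // [tS'|tB1|tB2]; first by rewrite tS' in tS.
    by case: (noB t y tB1 yB2); apply: edgeC.
  by case: (noB yi t yiB1 tB2).
have OB2 q : q \in attO C h -> q \notin B2.
  by case/attOP=> hq _; apply/negP=> qB2; case: (noB h q hB1 qB2).
(* If [B2] avoids [M 2 o], its vertices are on the rim; otherwise the degrees of [h], [yi] and some
   [z] in [B2] are counted. *)
case: (set_0Vmem (B2 :&: M 2 o)) => [B20|[z /setIP[zB2 z2]]].
  have z3 : z0 \in M 3 o.
    have : z0 \in B1 :|: B2 by rewrite in_setU z0B2 orbT.
    by rewrite EB => /setDP[].
  apply: (no_rim cC oY omin (z := z0)); split=> //.
  - by apply/negP=> z2; have := in_set0 z0; rewrite -B20 in_setI z0B2 z2.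
  - exact: noB.
  rewrite -SK; apply/subset_leq_card/subsetP=> x /setIP[/nbrsP zx xU].
  have x3 : x \in M 3 o.
    case/setUP: xU => [|/attOP[hx _]]; first exact: ball_mono.
    exact: ball_step ho hx.
  case: (Bcase x x3) => // [xB1|xB2]; first by case: (noB x z0 xB1 z0B2); apply: edgeC.
  case/setUP: xU => [x2|/OB2]; last by rewrite xB2.
  by have := in_set0 x; rewrite -B20 in_setI xB2 x2.
have hz : ~ e h z by apply: noB.
have yz : ~ e yi z by apply: noB.
have hz' : h != z by apply: contraTneq zB2 => <-; rewrite (disjointFr dB hB1).
have yz' : yi != z by apply: contraTneq zB2 => <-; rewrite (disjointFr dB yiB1).
have z3 : z \in M 3 o := ballW z2.
(* The bounds for the two sides count [S] twice and omit [h] and [z], so the degree sum stays two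
   below [#|M 3 o| + K o]. *)
have U1 : shadow C h :|: N yi \subset B1 :|: S.
  apply/subsetP=> x xU; have [x3 xB2] : x \in M 3 o /\ x \notin B2.
    case/setUP: xU => [/setUP[xY|xO]|/nbrsP yx].
    - by split; [apply: subsetP Yo _ xY | apply: YB2].
    - by split; [case/attOP: xO => hx _; apply: ball_step ho hx | apply: OB2].
    split; first exact: ball_step (YM _ yiY) yx.
    by apply/negP=> xB2; case: (noB yi x yiB1 xB2).
  rewrite in_setU; case: (Bcase x x3) => xB; rewrite ?xB ?orbT //.
  by rewrite xB in xB2.
have U2 : N z \subset B2 :|: S.
  apply/subsetP=> x /nbrsP zx; have x3 := ball_step z2 zx.
  rewrite in_setU; case: (Bcase x x3) => xB; rewrite ?xB ?orbT //.
  by case: (noB x z xB zB2); apply: edgeC.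
have hU : h \notin shadow C h :|: N yi.
  by rewrite in_setU negb_or (h_shadow hC) (notnbrs (attY_h lC hC yiY)).
have zU : z \notin N z by rewrite inE edge_irr.
have c1 := card_miss U1 (subsetP (subsetUl _ _) _ hB1) hU.
have c2 := card_miss U2 (subsetP (subsetUl _ _) _ zB2) zU.
have c3 : #|B1 :|: S| <= #|B1| + #|S| := leq_card_setU B1 S.
have c4 : #|B2 :|: S| <= #|B2| + #|S| := leq_card_setU B2 S.
have c5 := cards_disjU dB; rewrite EB in c5.
have c6 := cardsID S (M 3 o); rewrite (setIidPr SM) in c6.
have := deg_sum ho (YM _ yiY) z2 (attY_neq hC yiY) yz' hz' (attY_h lC hC yiY) yz hz.
rewrite (cards_disjU (attY_shadow lC hC yiY)) (card_shadow _ lC) in c1.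
rewrite [deg G yi]degE [deg G z]degE -SK; move: c1 c2 c3 c4 c5 c6; clear; lia.
Qed.


Lemma no_minimal_config C h o : config C h -> o \in attY C h -> ~ minimal o.
Proof.
move=> cC oY omin; have [lC hC W2] := cC.
have ho := attY_h2 lC oY; have oG := ball_center ho; have oo : o \in M 2 o := ball_refl 2 oG.
have [S Ssep] := min_cut (ballW ho) (ballW oo) (attY_neq hC oY) (attY_h lC hC oY).
have [SM SK Ssplit] := Ssep; have K2 := K_ge2 oG.
have hS := missed_in_cut cC oY omin Ssep.
have [yb [Bad [ybY ybo cB KW [BadP cover]]]] := exchange cC oY.
have BadS y : y \in Bad -> y \in S.
  by move=> yB; have [_ _ _ _ [D [cD oD _]]] := BadP y yB; apply: missed_in_cut cD oD omin Ssep.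
have hBad : h \notin Bad.
  by apply/negP=> /BadP[hY _ _ _ _]; have := attY_neq hC hY; rewrite eqxx.
have hBS : h |: Bad \subset S by apply/subsetP=> x /setU1P[->|/BadS].
have chB : #|h |: Bad| = #|Bad|.+1 by rewrite cardsU1 hBad.
(* The cut has [K o] elements, at most [#|Bad| + 1], so [h] and [Bad] exhaust it. *)
have SE : S = h |: Bad.
  by apply/eqP; rewrite eq_sym eqEcard hBS chB SK.
have ybS : yb \notin S.
  rewrite SE in_setU1 negb_or eq_sym (attY_neq hC ybY); apply/negP=> /BadP[_ _].
  by rewrite eqxx.
have oS : o \notin S.
  rewrite SE in_setU1 negb_or eq_sym (attY_neq hC oY); apply/negP=> /BadP[_].
  by rewrite eqxx.
have BadK : #|Bad| < K o by rewrite -SK SE chB.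
have YM y : y \in attY C h -> y \in M 2 o by apply: attY_dist.
have Yo : attY C h \subset M 3 o by apply/subsetP=> x /YM; apply: ballW.
have yb3 : yb \in M 3 o :\: S by rewrite in_setD ybS (ballW (YM _ ybY)).
have [B1 [B2 [ybB1 [z zB2] EB dB noB]]] := Ssplit yb yb3.
have Bcase x : x \in M 3 o -> [\/ x \in S, x \in B1 | x \in B2].
  move=> xM; case: (boolP (x \in S)) => xS; first by constructor 1.
  have : x \in B1 :|: B2 by rewrite EB in_setD xS.
  by case/setUP; [constructor 2|constructor 3].
have BM x : x \in B2 -> x \in M 3 o :\: S by move=> xB; rewrite -EB in_setU xB orbT.
have YB2 y : y \in attY C h -> y \notin B2.
  move=> yY; apply/negP=> yB2.
  have yyb : y != yb by apply: contraTneq yB2 => ->; rewrite (disjointFr dB ybB1).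
  have := attY_common lC hC yY ybY yyb Yo ho (YM y yY) (YM yb ybY); rewrite -SK => cK.
  have [t /setIP[/nbrsP yt /nbrsP ybt] tS] : exists2 t, t \in N y :&: N yb & t \notin S.
    by apply/subsetPn; apply: contraL cK => /subset_leq_card; rewrite -leqNgt.
  have t3 := ball_step (YM y yY) yt.
  case: (Bcase t t3) => // [tS'|tB1|tB2]; first by rewrite tS' in tS.
    by case: (noB t y tB1 yB2); apply: edgeC.
  by case: (noB yb t ybB1 tB2).
have oB1 : o \in B1.
  case: (Bcase o (ballW oo)) => // [oS'|oB2]; first by rewrite oS' in oS.
  by have := YB2 o oY; rewrite oB2.
have SY x : x \in S -> x = h \/ x \in attY C h.
  by rewrite SE => /setU1P[->|/BadP[]]; [left|right].
(* An attachment in [B2] has its successor in [Bad], hence is adjacent to [yb] in [B1]. Any other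
   vertex is joined to [o] by a middle vertex given by [cover], which would lie in [S]; but [h] and
   the successors are not adjacent to [o]. *)
have B2O x : x \in B2 -> x \in attO C h.
  move=> xB2; have /setDP[x3 xS] := BM x xB2; apply/negPn/negP=> xO.
  have xY : x \notin attY C h by apply: contraTN xB2 => /YB2.
  have xW : x \notin attW C h.
    apply/negP=> /attWP[hx xC]; have nY := attY_mem hx xC.
    have : next C x \in S.
      case: (Bcase _ (subsetP Yo _ nY)) => // [nB1|nB2]; last by have := YB2 _ nY; rewrite nB2.
      by case: (noB _ _ nB1 xB2); apply: edgeC; apply: next_edge.
    rewrite SE => /setU1P[nh|/BadP[_ _ _ [w [wE hw wC ybw]] _]].
      by have := attY_neq hC nY; rewrite nh eqxx.
    by apply: (noB yb x ybB1 xB2); rewrite (next_inj lC xC wC wE).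
  have [v ov vx] := cover BadK x x3 (noB _ _ ybB1 xB2) xY xW xO (noB _ _ oB1 xB2).
  case: (Bcase v (ballW (ballW (ball1_edge ov)))) => [/SY[vh|vY]|vB1|vB2].
  - by apply: (attY_h lC hC oY); rewrite -vh; apply: edgeC.
  - exact: (attY_nadj lC hC oY vY ov).
  - exact: (noB v x vB1 xB2).
  exact: (noB o v oB1 vB2).
(* [B2] lies in the component of [h], to which no vertex of [Bad] is adjacent, so removing [h] alone
   cuts it off from [o]. *)
have : K o <= #|[set h]|.
  apply: (@disconnected_kappa T G o [set h] B2 z o).
  - by rewrite sub1set; apply: ballW.
  - exact: zB2.
  - by rewrite in_setD in_set1 eq_sym (attY_neq hC oY) ballW.
  - by rewrite (disjointFr dB oB1).
  - have /setDP[z3 zS] := BM z zB2; rewrite in_setD z3 andbT in_set1.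
    by apply: contraNneq zS => ->.
  move=> a b aB2 /setDP[b3]; rewrite in_set1 => bh ab.
  case: (Bcase b b3) => [/SY[bh'|bY]|bB1|//]; first by rewrite bh' eqxx in bh.
    by case: (attY_comp lC hC bY (attO_comp hC (B2O a aB2)) (edgeC ab)).
  by case: (noB b a bB1 aB2 (edgeC ab)).
by rewrite cards1; move: K2; clear; lia.
Qed.

Lemma no_config C h : ~ config C h.
Proof.
suff no o : ~ is_center o.
  move=> cC; have [_ _ W2] := cC; have /card_gt0P[w /attWP[hw wC]] := ltnW W2.
  by apply: (no (next C w)); exists C, h; split=> //; apply: attY_mem.
(* Strong induction on [K o] provides the minimality. *)
have [n le_n] := ubnP (K o); elim: n => // n IH in o le_n *.
move=> [C' [h' [cC oY]]]; apply: (no_minimal_config cC oY) => v vc.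
by rewrite leqNgt; apply/negP=> lt_v; apply: (IH v) vc; move: lt_v le_n; clear; lia.
Qed.


(** * Missed vertices with at most one neighbour on the cycle *)

Lemma att_unique C q u v : longest C -> q \notin C -> e q u -> u \in C -> e q v -> v \in C -> u = v.
Proof.
move=> lC qC qu uC qv vC; apply/eqP/negPn/negP=> uv; apply: (@no_config C q); split=> //.
have uW : u \in attW C q by rewrite !inE qu.
have vW : v \in attW C q by rewrite !inE qv.
by rewrite (cardsD1 u) uW (cardsD1 v) in_setD1 eq_sym uv vW.
Qed.

Lemma disj_all (A B : {set T}) w : (forall x, x \in A -> x \in B -> x = w) ->
  [disjoint A :\ w & B :\ w].
Proof.
move=> h; apply: disjP => x /setD1P[xw xA] /setD1P[_ xB].
by rewrite (h x xA xB) eqxx in xw.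
Qed.

(** Otherwise the neighbourhoods of [q], [r] and [next C w] pairwise meet only in [w] and all miss
    [next C w], so the degree sum is at most [#|M 3 w| + 1]. *)
Lemma single_comp C w q r : longest C -> w \in C -> q \notin C -> r \notin C -> e w q -> e w r ->
  r \in comp C q.
Proof.
move=> lC wC qC rC wq wr; case: (boolP (r \in comp C q)) => // rq; exfalso.
set y := next C w; have wy : e w y := next_edge lC wC.
have qr : ~ e q r by move=> qr; case/negP: rq; apply: comp_edge.
have yq x : x \in comp C q -> ~ e y x := next_comp lC qC wC (comp_refl C q) (edgeC wq).
have yr x : x \in comp C r -> ~ e y x := next_comp lC rC wC (comp_refl C r) (edgeC wr).
have yqq := yq q (comp_refl C q); have yrr := yr r (comp_refl C r).
have qw x : x \in N q -> x = w \/ x \in comp C q.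
  move/nbrsP=> qx; case: (boolP (x \in C)) => xC; last by right; apply: comp_edge.
  by left; apply: att_unique lC qC qx xC (edgeC wq) wC.
have rw x : x \in N r -> x = w \/ x \in comp C r.
  move/nbrsP=> rx; case: (boolP (x \in C)) => xC; last by right; apply: comp_edge.
  by left; apply: att_unique lC rC rx xC (edgeC wr) wC.
have d1 : [disjoint N q :\ w & N r :\ w].
  apply: disj_all => x /qw[//|xq] /rw[//|/comp_sym xr].
  by case/negP: rq; apply: comp_trans xq xr.
have d2 : [disjoint N q :\ w & N y :\ w].
  by apply: disj_all => x /qw[//|xq] /nbrsP; move/(yq x xq).
have d3 : [disjoint N r :\ w & N y :\ w].
  by apply: disj_all => x /rw[//|xq] /nbrsP; move/(yr x xq).
have wG : w \in verts G := e_vertl wq.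
have M2 x : e w x -> x \in M 2 w by move=> wx; apply: ballW (ball1_edge wx).
have sub x : e w x -> N x :\ w \subset M 3 w.
  by move=> wx; apply: subset_trans (nbrs_ball (M2 x wx)); apply: subD1set.
set U := N q :\ w :|: N r :\ w :|: N y :\ w.
have UM : w |: U \subset M 3 w.
  by rewrite subUset sub1set ball_refl //= /U !subUset !sub.
have yC : y \in C by rewrite next_mem.
have qy : q != y by apply: contraNneq qC => ->.
have ry : r != y by apply: contraNneq rC => ->.
have qr' : q != r by apply: contraNneq rq => ->; apply: comp_refl.
have yU : y \notin w |: U.
  rewrite in_setU1 negb_or eq_sym (e_neq wy) /U; apply/negP.
  by case/setUP=> [/setUP[]|] /setD1P[_ /nbrsP] => [/edgeC|/edgeC|]; rewrite ?edge_irr.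
have := card_miss UM (ballW (M2 y wy)) yU.
rewrite cardsU1 /U cards_disj3 // !in_setU !in_setD1 eqxx /=.
have := deg_sum (M2 q wq) (M2 r wr) (M2 y wy) qr' ry qy qr (nedgeC yrr) (nedgeC yqq).
rewrite !degE (cardsD1 w (N q)) (cardsD1 w (N r)) (cardsD1 w (N y)) !inE !(edgeC wq, edgeC wr, edgeC wy).
by move: (K_ge2 wG); clear; lia.
Qed.

(** A count around a neighbour of [w] brings [z] within distance two of [y]. A second count, around
    [y] with shifted neighbours, overlaps the neighbourhood of [h] at most in [w] and [h1], which is
    too little. *)
Lemma nonadjacent_far C h w y z p h1 : longest C -> h \notin C -> w \in C -> e h w -> e w y ->
    y \in C -> (forall r, r \in comp C h -> ~ e y r) ->
    z \in C -> (forall r, r \in comp C h -> ~ e z r) ->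
    linked y z p -> (forall r, r \in comp C h -> e h r -> e y (succ_in p r) -> r = h1) ->
  z \notin M 3 w.
Proof.
move=> lC hC wC hw wy yC yH zC zH lk hn; apply/negP=> zw.
have hy : ~ e h y by move/edgeC; apply: yH; apply: comp_refl.
have hz : ~ e h z by move/edgeC; apply: zH; apply: comp_refl.
have yz : ~ e y z := linked_nadj lk; have yz' := linked_neq lk.
have hy' : h != y by apply: contraNneq hC => ->.
have hz' : h != z by apply: contraNneq hC => ->.
have Nh x : x \in N h -> x = w \/ x \in comp C h.
  move/nbrsP=> hx; case: (boolP (x \in C)) => xC; last by right; apply: comp_edge.
  by left; apply: att_unique lC hC hx xC hw wC.
have zy : z \in M 2 y.
  case: (ball_uncons zw) => [zw'|[v wv zv]]; first by case: hz; rewrite zw'.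
  have hv : h \in M 2 v := ball2_edges (edgeC wv) (edgeC hw).
  have yv : y \in M 2 v := ball2_edges (edgeC wv) wy.
  have := deg_sum hv yv zv hy' yz' hz' hy yz hz.
  case: (set_0Vmem (N y :&: N z)) => [N0|[t /setIP[/nbrsP yt /nbrsP zt]]]; last first.
    by move=> _; apply: ball2_common yt zt.
  have UM : N y :|: N z :|: N h \subset M 3 v by rewrite !subUset !nbrs_ball.
  have hU : h \notin N y :|: N z :|: N h.
    by apply/negP=> /setUP[/setUP[]|] /nbrsP => [/edgeC|/edgeC|]; rewrite ?edge_irr.
  have := card_miss UM (ballW hv) hU; rewrite cardsU cardsU N0 cards0.
  have : #|(N y :|: N z) :&: N h| <= 1.
    apply: (card_sub1 (x := w)) => x /setIP[xU /Nh[//|xH]].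
    by case/setUP: xU => /nbrsP; [move/(yH x xH)|move/(zH x xH)].
  rewrite !degE; move: (K_ge2 (ball_center zv)); clear; lia.
have yG : y \in verts G := e_vertr wy.
have hM : h \in M 2 y := ball2_edges (edgeC wy) (edgeC hw).
have yM : y \in M 2 y := ball_refl 2 yG.
have [pp Up Lp] := lk.
have UM : shift_nbrs p y :|: N z :|: N h \subset M 3 y.
  by rewrite !subUset (shift_ball (r := 1) Up pp) ?nbrs_ball //; apply: ball_refl.
have zU : z \notin shift_nbrs p y :|: N z :|: N h.
  apply/negP=> /setUP[/setUP[|/nbrsP]|/nbrsP] //; last by rewrite edge_irr.
  exact/negP/(last_shift lk).
have := card_miss UM (ballW zy) zU; rewrite cardsU (cards_disjU (shift_disj lk)).
have : #|(shift_nbrs p y :|: N z) :&: N h| <= 2.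
  have sub : (shift_nbrs p y :|: N z) :&: N h \subset [set w; h1].
    apply/subsetP=> x /setIP[xU xh]; rewrite in_set2; case: (Nh x xh) => [->|xH]; first by rewrite eqxx.
    case/setUP: xU => [|/nbrsP /(zH x xH) //]; rewrite inE => yx.
    by rewrite (hn x xH _ yx) ?eqxx ?orbT //; apply/nbrsP.
  by apply: leq_trans (subset_leq_card sub) _; rewrite cards2; case: (_ != _).
have := deg_sum hM yM zy hy' yz' hz' hy yz hz; have := linked_card lk.
by rewrite [deg G z]degE [deg G h]degE; move: (K_ge2 yG); clear; lia.
Qed.

(** The path visits the component in one block, and only at its last vertex does the successor leave
    the component. This supplies [h1] for [nonadjacent_far]. *)
Lemma block_exit C h y (s1 r s2 : seq T) x u v q : uniq (s1 ++ r ++ x :: s2) -> pathto u v r ->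
    {subset r <= comp C h} -> (forall a, a \in s1 ++ x :: s2 -> a \notin comp C h) ->
    (forall a, a \in comp C h -> ~ e y a) ->
  q \in comp C h -> e y (succ_in (s1 ++ r ++ x :: s2) q) -> q = v.
Proof.
move=> U pr rH sH yH qH yq; case: (boolP (q \in s1 ++ r ++ x :: s2)) => qp; last first.
  by rewrite succ_notin // in yq; case: (yH q qH).
have qr : q \in r.
  move: qp; rewrite mem_cat mem_cat orbCA -mem_cat => /orP[//|/sH].
  by rewrite qH.
case: (succ_block U qr) => [/rH nH|[[t E] _]]; first by case: (yH _ nH yq).
have [t' E'] := pathto_last pr; have := congr1 (last q) E.
by rewrite E' !last_rcons.
Qed.

(** Here the cycle is cut open just before [w], whereas [opened] cuts just after it. *)
Definition based C w t z := [/\ pathto w z (w :: t), e z w, uniq (w :: t), w :: t =i C &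
  [/\ size (w :: t) = size C, next C z = w
    & forall s1 x y s2, w :: t = s1 ++ x :: y :: s2 -> next C x = y]].

Lemma longest_based C w : longest C -> w \in C -> exists t z, based C w t z.
Proof.
move=> lC wC; have UC := longest_uniq lC; have [uC sC] := lC.
have [i t E] := rot_to wC; have [t' [z Et]] : exists t' z, t = rcons t' z.
  case: (lastP t) E => [|t' z] E; last by exists t', z.
  by have := size_rot i C; rewrite E sC /=; move: L_gt2; clear; lia.
have cyc : cycle e (w :: t) by rewrite -E rot_cycle; case/andP: uC.
have U1 : uniq (w :: t) by rewrite -E rot_uniq.
have nE x : next (w :: t) x = next C x by rewrite -E next_rot.
exists t, z; split=> //; last split.
- by move: cyc; rewrite /= rcons_path Et last_rcons eqxx eqxx => /andP[-> _].
- by move: cyc; rewrite /= rcons_path Et last_rcons => /andP[].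
- by move=> x; rewrite -E mem_rot.
- by rewrite -E size_rot.
- by rewrite -nE Et next_last // -Et.
by move=> s1 x y s2 E'; rewrite -nE; apply: next_cat U1 E'.
Qed.

Lemma pathto_tail a b x p : p != [::] -> pathto a b (x :: p) -> exists2 y, e a y & pathto y b p.
Proof.
case: p => // y p _ /and3P[/eqP-> /= /andP[ay yp] lb]; exists y => //.
by rewrite /= eqxx yp lb.
Qed.

Lemma linked_rot_succ a b p s x (t : seq T) : linked a b p -> p = s ++ x :: t -> t != [::] ->
  e a (succ_in p x) -> linked x b (rev (rcons s x) ++ t).
Proof.
move=> lk E; case: t E => // y t E _; rewrite E succ_cat => [ay|].
  exact: linked_rot lk E ay.
by rewrite -E; case: lk.
Qed.

(* Rotating the path through [h] that covers [C] until its end is adjacent to [v] yields an end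
   too close to [w].  If that end is itself attached to the component of [h], it lies before
   [w1] on the cycle and takes its place, whence the induction on [A]. *)
Lemma no_crossing C h w t z n A w1 (B : seq T) q v : longest C -> h \notin C -> w \in C -> e h w ->
    based C w t z -> t = A ++ w1 :: B -> size A < n -> q \in comp C h -> e q w1 ->
  next C w1 \notin M 3 w /\ (v \in C -> v \in M 2 w -> v \in M 2 w1 ->
    (forall r, r \in comp C h -> ~ e v r) -> False).
Proof.
move=> lC hC wC hw [pc zw Uc cC [szc nz nc]].
elim: n A w1 B q => // n IH A w1 B q tE; rewrite ltnS => sA qH qw1.
have hH := comp_refl C h.
have qC := comp_out hC qH.
have HC x : x \in C -> x \notin comp C h by apply: contraTN => /(comp_out hC).
have w1C : w1 \in C by rewrite -cC tE !inE mem_cat inE eqxx !orbT.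
case: A tE sA => [|y A] tE sA.
  by have := next_comp lC hC wC hH hw qH; rewrite (nc [::] w w1 B) ?tE // => /(_ (edgeC qw1)).
have yE : next C w = y by apply: (nc [::] w y (A ++ w1 :: B)); rewrite tE.
have yH r : r \in comp C h -> ~ e y r by rewrite -yE; apply: next_comp lC hC wC hH hw.
have wy : e w y by rewrite -yE; apply: next_edge.
have y1H r : r \in comp C h -> ~ e (next C w1) r by apply: next_comp lC hC w1C qH qw1.
have pcE : w :: t = (w :: y :: A) ++ w1 :: B by rewrite tE.
rewrite pcE in pc; have [p1 p2] := pathto_split pc.
have pA : pathto y w1 (rcons (y :: A) w1).
  have [y' _ py] := pathto_tail (p := rcons (y :: A) w1) isT p1.
  by case/and3P: (py) => /eqP yy' _ _; rewrite -yy' in py.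
have Bn : B != [::].
  apply/eqP=> B0; have w1z : w1 = z by move: p2; rewrite B0 => /and3P[_ _ /eqP].
  by apply: (y1H h hH); rewrite w1z nz; apply: edgeC.
have [y1 w1y1 pB] := pathto_tail Bn p2.
have y1E : next C w1 = y1.
  have [t2 Et2] := pathto_head pB.
  by apply: (nc (w :: y :: A) w1 y1 t2); rewrite pcE Et2.
rewrite y1E in y1H *.
have [r [pr Ur rH]] := comp_path hC qH.
have rC x : x \in r -> x \notin C by move/rH; apply: comp_out.
(* From [y1] forward to [w], through the component from [h] to [q], then from [w1] backwards to
   [y]. *)
pose p0 := B ++ w :: r ++ w1 :: rev (y :: A).
have Urc : uniq (r ++ (w :: t)).
  rewrite cat_uniq Ur Uc andbT; apply/hasPn=> x; rewrite cC; by apply: contraL => /rC.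
have pe0 : perm_eq p0 (r ++ (w :: t)).
  apply/permP=> P; rewrite /p0 tE /= !count_cat /= !count_cat /= count_rev /=; clear; lia.
have r0 : 0 < size r by case: (r) pr.
have lk : linked y1 y p0.
  split.
  - apply: pathto_cat pB zw (pathto_cons (edgeC hw) (pathto_cat pr qw1 _)).
    by rewrite -rev_rcons; apply: pathto_rev.
  - by rewrite (perm_uniq pe0).
  by rewrite (perm_size pe0) size_cat szc; case: (lC) => _ ->; rewrite -{1}[L]add0n ltn_add2r.
have Up0 : uniq p0 by case: lk.
have ABC x : x \in (y :: A) ++ w1 :: B -> x \in C.
  by move=> xt; rewrite -cC tE in_cons xt orbT.
have AC x : x \in y :: A -> x \in C by move=> xA; apply: ABC; rewrite mem_cat xA.
have BC x : x \in B -> x \in C by move=> xB; apply: ABC; rewrite mem_cat !in_cons xB !orbT.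
have yC : y \in C by apply: AC; rewrite inE eqxx.
have y1C : y1 \in C by rewrite -y1E next_mem.
have far : y1 \notin M 3 w.
  have := linked_rev lk.
  have -> : rev p0 = rcons (y :: A) w1 ++ rev r ++ w :: rev B.
    by rewrite /p0 rev_cat rev_cons rev_cat rev_cons revK -!cats1 -!catA.
  move=> lk'; have [_ U' _] := lk'.
  apply: (nonadjacent_far (h1 := h) lC hC wC hw wy yC yH y1C y1H lk') => a aH _.
  apply: (block_exit U' (pathto_rev pr) _ _ yH aH) => b.
    by rewrite mem_rev; apply: rH.
  rewrite mem_cat mem_rcons !in_cons mem_rev => bE; apply: HC.
  by case/or3P: bE => [/orP[/eqP->//|bA]|/eqP->//|/BC//]; apply: AC; rewrite in_cons.
split=> // vC vw vw1 vH.
have y1v : y1 != v by apply: contraNneq far => ->; apply: ballW.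
have y1v' : ~ e y1 v by move/edgeC=> vy; case/negP: far; apply: ball_step vw vy.
have qv : ~ e q v by move/edgeC; apply: vH.
have qy1 : ~ e q y1 by move/edgeC; apply: y1H.
have qy1' : q != y1 by apply: contraNneq qC => ->.
have qv' : q != v by apply: contraNneq qC => ->.
have qM : q \in M 2 w1 := ballW (ball1_edge (edgeC qw1)).
have y1M1 := ball1_edge w1y1; have y1M := ballW y1M1.
have w1w : w1 != w.
  by apply: contraTneq Uc => <-; rewrite tE cons_uniq mem_cat !in_cons eqxx !orbT.
have nw : succ_in p0 w \in comp C h.
  have [r' Er] := pathto_head pr; rewrite /p0 Er cat_cons succ_cat //.
  by rewrite -cat_cons -Er.
have [pp0 _ _] := lk.
(* Looks for a rotation whose new end [x] is adjacent to [v]. Without one, the sets counted around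
   [w1] overlap only in [w1]; if [v] is adjacent to [w1] this overlap may count twice, and the
   uncounted [w] compensates. *)
have [x [xs vx xw1]] : exists x, [/\ x \in shift_nbrs p0 y1, e v x & x != w1].
  case: (pickP [pred x | [&& x \in shift_nbrs p0 y1, e v x & x != w1]]) => [x /and3P[]|none].
    by exists x.
  have only x : x \in shift_nbrs p0 y1 -> e v x -> x = w1.
    by move=> xs vx; apply/eqP; have := none x; rewrite /= xs vx /= => /negbFE.
  exfalso.
  have Nq a : a \in N q -> a = w1 \/ a \in comp C h.
    move/nbrsP=> qa; case: (boolP (a \in C)) => aC; last by right; apply: comp_step qH qa aC.
    by left; apply: att_unique lC qC qa aC qw1 w1C.
  have i3 : #|(shift_nbrs p0 y1 :|: N v) :&: N q| <= 1.
    apply: (card_sub1 (x := w1)) => a /setIP[aU aq]; case: (Nq a aq) => // aH.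
    case/setUP: aU => [|/nbrsP/(vH a aH)//]; rewrite inE => y1a.
    have : p0 = rcons B w ++ r ++ w1 :: rev (y :: A) by rewrite cat_rcons.
    move=> Ep0; rewrite Ep0 in y1a Up0; move/nbrsP: aq => qa.
    have aE := block_exit Up0 pr rH _ y1H aH y1a.
    rewrite aE ?edge_irr // in qa.
    move=> b; rewrite mem_cat mem_rcons !in_cons mem_rev => bE; apply: HC.
    by case/orP: bE => [/orP[/eqP->//|/BC//]|/orP[/eqP->//|/AC//]].
  have i2 : #|shift_nbrs p0 y1 :&: N v| <= 1.
    by apply: (card_sub1 (x := w1)) => a /setIP[xs /nbrsP]; apply: only.
  have UM : shift_nbrs p0 y1 :|: N v :|: N q \subset M 3 w1.
    by rewrite !subUset (shift_ball (r := 1) Up0 pp0) // !nbrs_ball.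
  have := deg_sum qM y1M vw1 qy1' y1v qv' qy1 y1v' qv.
  have := linked_card lk; have := K_ge2 (e_vertr qw1).
  have := subset_leq_card UM.
  rewrite cardsU cardsU [deg G v]degE [deg G q]degE.
  case: (boolP (e v w1)) => vw1e; last first.
    have : shift_nbrs p0 y1 :&: N v = set0.
      apply/setP=> a; rewrite in_set0; apply/negP=> /setIP[xs /nbrsP va].
      by case/negP: vw1e; rewrite -(only a xs va).
    by move=> ->; rewrite cards0; move: i3; clear; lia.
  have wM : w \in M 3 w1.
    by apply: ball_cons (edgeC vw1e) (ball_sym (e_vertr hw) vw).
  have wU : w \notin shift_nbrs p0 y1 :|: N v :|: N q.
    apply/negP=> /setUP[/setUP[|/nbrsP vw']|/nbrsP qw].
    - by rewrite inE; apply: y1H.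
    - by case/negP: far; apply: ball_step (ball2_edges (edgeC vw') vw1e) w1y1.
    by have := att_unique lC qC qw wC qw1 w1C => E; rewrite E eqxx in w1w.
  have := card_miss UM wM wU; rewrite cardsU cardsU.
  by move: i2 i3; clear; lia.
have y1x : e y1 (succ_in p0 x) by move: xs; rewrite inE.
have xH : x \notin comp C h by apply/negP=> xH; case: (vH x xH vx).
have xC : x \in C.
  case: (boolP (x \in C)) => // xC; have xp : x \notin p0.
    rewrite (perm_mem pe0) mem_cat cC negb_or xC andbT.
    by apply: contraNN xH => /rH.
  rewrite succ_notin // in y1x.
  by have := att_unique lC xC (edgeC y1x) y1C (edgeC vx) vC => E; rewrite E eqxx in y1v.
have xM : x \in M 3 w := ball_step vw vx.
have xw : x != w by apply: contraPneq y1x => ->; apply: y1H.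
have xy : x != y by apply: contraTneq xs => ->; apply: (last_shift lk).
have : x \in (y :: A) ++ w1 :: B by move: xC; rewrite -cC tE in_cons (negbTE xw).
(* If [x] is attached to the component, the induction applies before [w1], and a cycle that is too
   long arises after it. If not, [nonadjacent_far] puts [x] too far from [w], contrary to the walk
   through [v]. *)
rewrite mem_cat [x \in w1 :: B]in_cons (negbTE xw1) /= => /orP[xA|xB].
  have [a1 [a2 EA]] : exists s1 s2, rev (y :: A) = s1 ++ x :: s2.
    have : x \in rev (y :: A) by rewrite mem_rev.
    by case/splitPr=> s1 s2; exists s1, s2.
  have EA' : y :: A = rev a2 ++ x :: rev a1.
    by rewrite -[LHS]revK EA rev_cat rev_cons cat_rcons.
  have xHN s : s \in comp C h -> ~ e x s.
    move=> sH xs'; have tE' : t = rev a2 ++ x :: (rev a1 ++ w1 :: B).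
      by rewrite tE EA' -catA.
    have sA' : size (rev a2) < n.
      by apply: leq_trans sA; rewrite EA' size_cat /=; clear; lia.
    have [_ IHv] := IH _ _ _ _ tE' sA' sH (edgeC xs').
    by apply: IHv vC vw _ vH; apply: ballW (ball1_edge (edgeC vx)).
  have a2n : a2 != [::].
    apply: contraNneq xy => a20; move: EA'; rewrite a20 /= => -[->].
    by [].
  have Ep : p0 = (B ++ w :: r ++ w1 :: a1) ++ x :: a2.
    by rewrite /p0 EA -catA /= -catA.
  have := linked_rev (linked_rot_succ lk Ep a2n y1x).
  have -> : rev (rev (rcons (B ++ w :: r ++ w1 :: a1) x) ++ a2) =
      (rev a2 ++ rcons B w) ++ r ++ w1 :: rcons a1 x.
    by rewrite rev_cat revK -!cats1 -!catA /= -!catA.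
  move=> lk'; have [_ U' _] := lk'; 
  suff: x \notin M 3 w by rewrite xM.
  apply: (nonadjacent_far (h1 := q) lC hC wC hw wy yC yH xC xHN lk') => a aH _.
  apply: (block_exit U' pr rH _ yH aH) => b.
  rewrite !mem_cat !in_cons !mem_rcons !in_cons mem_rev => bE; apply: HC.
  have a12 u : u \in a1 \/ u \in a2 -> u \in C.
    by move=> ua; apply: AC; rewrite EA' mem_cat in_cons !mem_rev; case: ua => ->; rewrite ?orbT.
  by case/orP: bE => [/orP[ba|/orP[/eqP->//|/BC//]]|/or3P[/eqP->//|/eqP->//|ba]];
    apply: a12; [right|left].
have [b1 [b2 EB]] : exists s1 s2, B = s1 ++ x :: s2 by case/splitPr: (xB) => s1 s2; exists s1, s2.
pose rest := b2 ++ w :: r ++ w1 :: rev (y :: A).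
have Ep : p0 = b1 ++ x :: rest by rewrite /p0 EB -catA.
have restn : rest != [::] by rewrite /rest; case: (b2).
have lkx := linked_rot_succ lk Ep restn y1x.
have b12 u : u \in b1 \/ u \in b2 -> u \in C.
  by move=> ub; apply: BC; rewrite EB mem_cat in_cons; case: ub => ->; rewrite ?orbT.
have xHN s : s \in comp C h -> ~ e x s.
  move=> sH xs'; have [px _ _] := lkx.
  rewrite /rest catA in px; have [px' _] := pathto_split px.
  have [r' [pr' Ur' rH']] := comp_path qC (comp_trans (comp_sym qH) sH).
  have rC' u : u \in r' -> u \notin C by move/rH'; apply: comp_out.
  set s1 := rcons _ w in px'.
  suff lk2 : linked x s (s1 ++ rcons (y :: A) w1 ++ r').
    by apply: (no_long_cycle lk2); apply: edgeC.
  have pe : perm_eq (s1 ++ rcons (y :: A) w1 ++ r') (r' ++ w :: t).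
    apply/permP=> P; rewrite /s1 tE EB -!cats1 !count_cat count_rev /= !count_cat /= !count_cat /=.
    by move: (count P A) (count P b1) (count P b2) (count P r') (P x) (P w) (P w1) (P y); clear; lia.
  split.
  - exact: pathto_cat px' wy (pathto_cat pA (edgeC qw1) pr').
  - rewrite (perm_uniq pe) cat_uniq Ur' Uc andbT; apply/hasPn=> u; rewrite cC.
    by apply: contraL => /rC'.
  have r0' : 0 < size r' by case: (r') pr'.
  by rewrite (perm_size pe) size_cat szc; case: (lC) => _ ->; rewrite -{1}[L]add0n ltn_add2r.
have := linked_rev lkx.
have -> : rev (rev (rcons b1 x) ++ rest) =
    rcons (y :: A) w1 ++ rev r ++ w :: (rev b2 ++ rcons b1 x).
  by rewrite rev_cat revK /rest rev_cat rev_cons rev_cat rev_cons revK -!cats1 -!catA.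
move=> lk'; have [_ U' _] := lk'; 
  suff: x \notin M 3 w by rewrite xM.
  apply: (nonadjacent_far (h1 := h) lC hC wC hw wy yC yH xC xHN lk') => a aH _.
apply: (block_exit U' (pathto_rev pr) _ _ yH aH) => b; first by rewrite mem_rev; apply: rH.
rewrite mem_cat mem_rcons !in_cons mem_cat mem_rev mem_rcons in_cons => bE; apply: HC.
case/orP: bE => [/orP[/eqP->//|bA]|/or3P[/eqP->//|bb|/orP[/eqP->//|bb]]].
- by apply: AC; rewrite in_cons.
- by apply: b12; right.
by apply: b12; left.
Qed.


Lemma attached_far C h w w1 q : longest C -> h \notin C -> w \in C -> e h w -> q \in comp C h ->
  e q w1 -> w1 \in C -> w1 != w -> next C w1 \notin M 3 w.
Proof.
move=> lC hC wC hw qH qw1 w1C w1w; have [t [z bt]] := longest_based lC wC.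
have: w1 \in t by have [_ _ _ cC _] := bt; move: w1C; rewrite -cC in_cons (negbTE w1w).
move=> w1t; case/splitPr: t / w1t bt => A B bt.
by have [] := no_crossing w lC hC wC hw bt (erefl _) (ltnSn _) qH qw1.
Qed.

(** Within its ball [w] would be a cut vertex, separating the component of [h] and its other
    attachments from the successor of [w]. *)
Lemma no_missed_neighbor C h w : longest C -> h \notin C -> w \in C -> ~ e h w.
Proof.
move=> lC hC wC hw; have wG := e_vertr hw; have hH := comp_refl C h.
pose X := [set x | (x \in comp C h) || [&& x \in C, x != w & [exists q in comp C h, e q x]]].
have wy := next_edge lC wC.
suff: K w <= #|[set w]| by rewrite cards1; move: (K_ge2 wG); clear; lia.
have wh : w != h by apply: contraNneq hC => <-.
apply: (@disconnected_kappa T G w [set w] X h (next C w)).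
- by rewrite sub1set ball_refl.
- by rewrite in_set hH.
- by rewrite in_setD in_set1 eq_sym (e_neq wy) (ballW (ballW (ball1_edge wy))).
- rewrite in_set negb_or; apply/andP; split.
    by apply: contraTN (wC) => /(comp_out hC); rewrite next_mem.
  rewrite !negb_and; apply/orP; right; apply/orP; right; apply/exists_inP=> -[q qH].
  by move/edgeC; apply: next_comp lC hC wC hH hw qH.
- by rewrite in_setD in_set1 eq_sym wh (ballW (ballW (ball1_edge (edgeC hw)))).
move=> w1 u w1X /setDP[u3]; rewrite in_set1 => uw w1u.
apply/negPn/negP; rewrite in_set negb_or => /andP[uH uA].
have uN q : q \in comp C h -> u \in C -> ~ e q u.
  by move=> qH uC qu; case/negP: uA; rewrite uC uw; apply/exists_inP; exists q.
move: w1X; rewrite in_set => /orP[w1H|/and3P[w1C w1w /exists_inP[q qH qw1]]].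
  case: (boolP (u \in C)) => uC; first exact: uN w1H uC w1u.
  by rewrite (comp_step hC w1H w1u uC) in uH.
have qC := comp_out hC qH.
have uC : u \in C.
  case: (boolP (u \in C)) => // uC.
  by rewrite (comp_trans qH (single_comp lC w1C qC uC (edgeC qw1) w1u)) in uH.
have cross v : v \in C -> v \in M 2 w -> v \in M 2 w1 -> (forall r, r \in comp C h -> ~ e v r) -> False.
  have [t [z bt]] := longest_based lC wC.
  have: w1 \in t by have [_ _ _ cC _] := bt; move: w1C; rewrite -cC in_cons (negbTE w1w).
  move=> w1t; case/splitPr: t / w1t bt => A B bt.
  by have [_] := no_crossing v lC hC wC hw bt (erefl _) (ltnSn _) qH qw1.
have uH' r : r \in comp C h -> ~ e u r by move=> rH /edgeC; apply: uN.
case: (boolP (u \in M 2 w)) => u2; first exact: (cross u uC u2 (ballW (ball1_edge w1u)) uH').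
(* On a walk of length three from [w] to [u], the vertex [q2] before [u] lies on [C], is not
   attached, and is within distance two of [w] and of [w1], so it can take the place of [u]. *)
have [uw'|[q1 wq1 /ball2P[uq|q1u|[q2 q12 q2u]]]] := ball_uncons u3.
- by rewrite uw' eqxx in uw.
- by case/negP: u2; rewrite uq; apply: ballW (ball1_edge wq1).
- by case/negP: u2; apply: ball2_edges wq1 q1u.
have q22 : q2 \in M 2 w := ball2_edges wq1 q12.
have q2w : q2 != w by apply: contraNneq u2 => q2w; apply: ballW (ball1_edge _); rewrite -q2w.
have q2far r : r \in comp C h -> q2 \in C -> ~ e r q2.
  move=> rH q2C rq2; have := attached_far lC hC wC hw rH rq2 q2C q2w.
  by rewrite (ball_step q22 (next_edge lC q2C)).
have q2H : q2 \notin comp C h by apply/negP=> q2H; apply: uH' q2H (edgeC q2u).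
have q1C : q1 \in C.
  case: (boolP (q1 \in C)) => // q1C.
  have q1H := single_comp lC wC hC q1C (edgeC hw) wq1.
  case: (boolP (q2 \in C)) => q2C; first by case: (q2far q1 q1H q2C).
  by rewrite (comp_step hC q1H q12 q2C) in q2H.
have q2C : q2 \in C.
  case: (boolP (q2 \in C)) => // q2C.
  have q1u := att_unique lC q2C (edgeC q12) q1C q2u uC.
  by case/negP: u2; rewrite -q1u; apply: ballW (ball1_edge wq1).
apply: (cross q2 q2C q22 (ball2_edges w1u (edgeC q2u))) => r rH /edgeC.
exact: q2far.
Qed.

Lemma longest_spanning C : connected G -> longest C -> C =i verts G.
Proof.
move=> cG lC; have [uC sC] := lC.
have CG x : x \in C -> x \in verts G by move/(next_edge lC)/e_vertl.
move=> x; apply/idP/idP => [/CG //|xG].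
have [w wC] : exists w, w \in C.
  by case: (C) sC => [|w t] sC; [move: L_gt2; rewrite -sC | exists w; rewrite inE eqxx].
have /connectP[p] := forall_inP (forall_inP cG w (CG w wC)) x xG.
elim: p w wC => [|a p IH] w wC /= => [_ -> //|/andP[wa pa] xE].
apply: IH pa xE; apply/negPn/negP=> aC.
exact: (no_missed_neighbor lC aC wC (edgeC wa)).
Qed.

End Longest.

(** * Existence of a cycle *)

Section CycleExistence.
Variables (T : finType) (G : sgraph T).
Local Notation e := (edge G).

(** When a path cannot be extended at [x], all neighbours of [x] are on it, and one not next to [x]
    on the path closes a cycle. *)
Lemma min_degree_cycle (x0 : T) : x0 \in verts G ->
  (forall v, v \in verts G -> exists a b, [/\ a != b, e v a & e v b]) ->
  exists c, ucycle e c /\ 2 < size c.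
Proof.
move=> x0G deg2.
have ext : forall k x (p : seq T), #|T| - size p <= k -> x \in verts G -> path e x p -> uniq (x :: p) ->
    exists c, ucycle e c /\ 2 < size c.
  elim=> [|k IH] x p sp xG pp Up.
    have : size p < #|T| by rewrite -[X in X <= _](card_uniqP Up) max_card.
    by move: sp; rewrite leqn0 subn_eq0 leqNgt => /negbTE->.
  case: (boolP [exists a, e x a && (a \notin x :: p)]) => [/existsP[a /andP[xa aN]]|].
    apply: (IH a (x :: p)).
    - move: sp => /=; clear; lia.
    - exact: e_vertr xa.
    - by rewrite /= (edgeC xa).
    by rewrite cons_uniq aN.
  rewrite negb_exists => /forallP nN.
  have inp a : e x a -> a \in p.
    by move=> xa; have := nN a; rewrite xa negbK inE eq_sym (negbTE (e_neq xa)).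
  have [a [b [ab xa xb]]] := deg2 x xG.
  have [c xc cp] : exists2 c, e x c & c != head x p.
    by case: (eqVneq a (head x p)) ab => [<-|nb] ab; [exists b; rewrite // eq_sym|exists a].
  have cp' := inp c xc; case/splitPr: p / cp' pp Up cp {sp inp nN} => p1 p2 pp Up cp.
  exists (x :: rcons p1 c); split; last first.
    by case: p1 cp {pp Up} => [|y p1] /=; rewrite ?eqxx // size_rcons.
  move: pp Up; rewrite -cat_rcons cat_path -cat_cons cat_uniq => /andP[pp _] /andP[Up _].
  by rewrite /ucycle Up andbT /= rcons_path pp last_rcons (edgeC xc).
by apply: (ext #|T| x0 [::]); rewrite ?leq_subr.
Qed.

(** Removing the neighbours of [v] isolates [v] or leaves it alone, so there are at least two of
    them. *)
Lemma kappa_deg2 v : v \in verts G -> 2 <= ball_conn G v -> exists a b, [/\ a != b, e v a & e v b].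
Proof.
move=> vG K2; have v3 : v \in ball_verts G 3 v by apply: ball_refl.
case: (boolP [exists a, exists b, [&& a != b, e v a & e v b]]) => [/existsP[a /existsP[b /and3P[]]]|].
  by exists a, b.
rewrite negb_exists => /forallP nab; exfalso.
have uniqN a b : e v a -> e v b -> a = b.
  move=> va vb; apply/eqP/negPn/negP=> ab; have := nab a; rewrite negb_exists => /forallP/(_ b).
  by rewrite ab va vb.
have N1 : #|nbrs G v| <= 1.
  by apply/card_le1_eqP => a b; rewrite !inE => va vb; apply: uniqN.
have NM : nbrs G v \subset ball_verts G 3 v by apply: nbrs_ball; apply: ball_refl.
have vN : v \notin nbrs G v by rewrite inE edge_irr.
suff : ball_conn G v <= #|nbrs G v| by move: K2 N1; clear; lia.
have vM : v \in ball_verts G 3 v :\: nbrs G v by rewrite in_setD vN.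
case: (leqP #|ball_verts G 3 v :\: nbrs G v| 1) => [triv|].
  apply: kappa_min; rewrite /cutting verts_ball NM /=; apply/orP; right.
  by rewrite /trivial_graph verts_remove.
rewrite (cardsD1 v) vM ltnS => /card_gt0P[x /setD1P[xv xM]].
apply: (@disconnected_kappa T G v _ [set v] v x) => //; rewrite ?set11 ?in_set1 //.
by move=> a b /set1P-> /setDP[_ bN] vb; rewrite inE vb in bN.
Qed.

End CycleExistence.

(** * Hamiltonicity from a longest cycle *)

Theorem theorem11 (T : finType) (G : sgraph T)
  (G_conn : connected G)
  (G_size : 3 <= #|verts G|)
  (ball_2conn : forall v, v \in verts G -> k_connected 2 (ball G 3 v))
  (deg_sum : forall v, v \in verts G ->
     forall x y z,
       interior G 3 v x -> interior G 3 v y -> interior G 3 v z ->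
       x != y -> y != z -> x != z ->
       ~~ edge G x y -> ~~ edge G y z -> ~~ edge G x z ->
       #|ball_verts G 3 v| + kappa (ball G 3 v) <= deg G x + deg G y + deg G z) :
  hamiltonian G.
Proof.
have /card_gt0P[x0 x0G] : 0 < #|verts G| by apply: leq_trans G_size.
have K2 v : v \in verts G -> 2 <= ball_conn G v by apply: ball_2conn.
have [c0 [uc0 sc0]] := min_degree_cycle x0G (fun v vG => kappa_deg2 vG (K2 v vG)).
have sz c : ucycle (edge G) c -> size c <= #|T|.
  by case/andP=> _ Uc; rewrite -(card_uniqP Uc) max_card.
pose P L := [exists t : L.-tuple T, ucycleb (edge G) t && (2 < L)].
have P0 : exists L, P L.
  by exists (size c0); apply/existsP; exists (in_tuple c0); apply/andP.
have Pmax L : P L -> L <= #|T|.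
  by case/existsP=> t /andP[/sz]; rewrite size_tuple.
have [L /existsP[C /andP[uC L2]] Lmax] := ex_maxnP P0 Pmax.
have L_max c : ucycle (edge G) c -> 2 < size c -> size c <= L.
  by move=> uc sc; apply: Lmax; apply/existsP; exists (in_tuple c); apply/andP.
exists C; split=> //; first by rewrite size_tuple.
apply: (longest_spanning K2 _ L2 L_max G_conn); last by split; rewrite ?size_tuple.
move=> v x y z xv yv zv xy yz xz exy eyz exz.
apply: deg_sum => //; try exact/negP; try exact: interior2.
exact: ball_center xv.
Qed.
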